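(* Consider the dynamic programming equation $$\tilde R(k,X,n)=\min\bigl(\tilde R_1(k,X,n),\tilde R_2(k,X,n)\bigr),$$ where $k,n$ are nonnegative multiples of $M$ with $k+n\le N$, $X\in\mathbb{R}$ (with $X=0$ when $n=0$), $\tilde R_1(k,X,n)=\tilde R_2(k,X,n)=0$ for $k+n=N$, and $$\tilde R_1(k,X,n)=M\tilde g_1(X,n)+\tilde R(k+M,X,n),$$ $$\tilde R_2(k,X,n)=M\tilde g_2(X,n)+\int_{-\infty}^{+\infty}\tilde R(k,X+Y,n+M)\,h_{n,M}(MX-nY)\,dY$$ for $0\le k+n<N$. Here $$\tilde g_1(X,n)=\int_0^C m\, f_{nD}(X\,|\,nm)\,\lambda(m)\,dm,\qquad \tilde g_2(X,n)=\int_{-C}^0 |m|\, f_{nD}(X\,|\,nm)\,\lambda(m)\,dm,$$ and $$h_{0,M}(Y)=1,\qquad h_{n,M}(Y)=(n+M)\,f_{nMD(n+M)}(Y)\quad (n>0).$$ Then the Bayesian risk (over strategies that process the data in batches of size $M$) is $$R^B_N(\lambda)=\tilde R(0,0,0).$$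
   Context: Gaussian densities: for a variance $V>0$, $f_V(x|a)=(2\pi V)^{-1/2}\exp\{-(x-a)^2/(2V)\}$ and $f_V(x)=f_V(x|0)$. Convention: for $n=0$ one has $X=0$ and $f_{nD}(X|nm)$ is replaced by $1$. Gaussian one-armed bandit: fix $D>0$, $0<C<\infty$ and positive integers $N,M$ with $N$ a multiple of $M$. At each step $i=1,\dots,N$ an action $y_i\in\{1,2\}$ is chosen and a random income $\xi_i$ depending only on the current action is received. If $y_i=2$, $\xi_i$ has density $f_D(x|m)$ with $D$ known and $m$ unknown; if $y_i=1$, $\xi_i$ has a known distribution with expectation $0$. The parameter is $\theta=(0,m)$, with $\Theta=\{\theta=(0,m):|m|\le C\}$. Strategies: the history is described by $(k,X,n)$, where $k,n$ are the numbers of past applications of the first and the second action and $X$ is the cumulative income from the second action ($X=0$ if $n=0$). A strategy $\sigma$ assigns to each history a (possibly randomized) selection of the next action, and only strategies that may change the action after applying it $M$ times in succession are used: a selection is made when $k,n$ are multiples of $M$ and the selected action is used for the next $M$ steps. Loss: $L_N(\sigma,\theta)=N\max(0,m)-\mathrm{E}_{\sigma,\theta}\bigl(\sum_{i=1}^N\xi_i\bigr)$. Prior: $\lambda$ is a probability density of $m$ on $[-C,C]$ with $\int_{-C}^0|m|\lambda(m)\,dm>0$ and $\int_0^C m\lambda(m)\,dm>0$. Bayesian risk: $R^B_N(\lambda)=\min_{\sigma}\int_{-C}^{C}L_N(\sigma,(0,m))\,\lambda(m)\,dm$. *)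

(* Defs.v *)
From HB Require Import structures.
From mathcomp Require Import all_boot all_order all_algebra.
From mathcomp Require Import all_classical all_reals all_analysis.

Set Implicit Arguments.
Unset Strict Implicit.
Unset Printing Implicit Defensive.
Import Order.TTheory GRing.Theory Num.Theory.
Import numFieldNormedType.Exports.
Local Open Scope classical_set_scope.
Local Open Scope ring_scope.

(* f_V(x|a); normal_pdf is parametrized by the standard deviation. *)
Definition gauss (R : realType) (V a x : R) : R :=
  normal_pdf a (Num.sqrt V) x.

(* f_{nD}(X|nm), replaced by 1 for n = 0 *)
Definition lik (R : realType) (D : R) (n : nat) (X m : R) : R :=
  if n == 0%N then 1 else gauss (n%:R * D) (n%:R * m) X.

(* h_{n,M}(Y) *)
Definition hker (R : realType) (D : R) (M n : nat) (Y : R) : R :=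
  if n == 0%N then 1
  else (n + M)%:R * gauss (n%:R * M%:R * D * (n + M)%:R) 0 Y.

Inductive action := arm1 | arm2.

(* [select k X n] is the probability of selecting the first action at history
   (k, X, n); arm2 is selected with the complementary probability. *)
Record strategy (R : realType) := Strategy {
  select : nat -> R -> nat -> R ;
  select_prob : forall k X n, 0 <= select k X n <= 1 ;
  select_measurable : forall k n,
    measurable_fun [set: R] (fun X => select k X n) }.

(* (k, X, n) together with the action applied last *)
Record history (R : realType) := History {
  napp1 : nat ; income2 : R ; napp2 : nat ; last_action : action }.

(* The last action is irrelevant here: a selection is always made at (0,0,0). *)
Definition history0 (R : realType) : history R := History 0 0 0 arm1.

(* Randomness available at one step: a variable u, uniform on [0, 1] and used
   to randomize the selection, and the incomes (x1, x2) that the first and the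
   second action would bring at this step. Only the income of the action
   actually applied is received. *)
Notation noise R :=
  (measurableTypeR R * measurableTypeR R * measurableTypeR R)%type.

Definition next_action (R : realType) (M : nat) (sigma : strategy R)
    (s : history R) (w : noise R) : action :=
  if (M %| napp1 s)%N && (M %| napp2 s)%N then
    if w.1.1 < select sigma (napp1 s) (income2 s) (napp2 s) then arm1 else arm2
  else last_action s.

Definition income (R : realType) (a : action) (w : noise R) : R :=
  if a is arm1 then w.1.2 else w.2.

Definition update (R : realType) (s : history R) (a : action) (x : R) :
    history R :=
  match a with
  | arm1 => History (napp1 s).+1 (income2 s) (napp2 s) arm1
  | arm2 => History (napp1 s) (income2 s + x) (napp2 s).+1 arm2
  end.

(* The successive incomes xi_1, xi_2, ... received from history s on *)
Fixpoint incomes (R : realType) (M : nat) (sigma : strategy R)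
    (s : history R) (ws : seq (noise R)) : seq R :=
  if ws is w :: ws' then
    let a := next_action M sigma s w in
    let x := income a w in
    x :: incomes M sigma (update s a x) ws'
  else [::].

Section noises.
Variables (R : realType) (D : R) (nu1 : probability (measurableTypeR R) R).
Variable m : R.

Definition noise_law : probability (noise R) R :=
  ((uniform_prob (@ltr01 R) \x nu1) \x normal_prob m (Num.sqrt D))%E.

Definition tcons n (p : noise R * n.-tuple (noise R)) : n.+1.-tuple (noise R) :=
  [tuple of p.1 :: p.2].

Lemma measurable_tcons n : measurable_fun setT (@tcons n).
Proof. exact: measurable_cons. Qed.

HB.instance Definition _ n :=
  isMeasurableFun.Build _ _ _ _ (@tcons n) (@measurable_tcons n).

(* The N-fold product of noise_law: the noises of the N steps are i.i.d. *)
Fixpoint noises_law (N : nat) : probability (N.-tuple (noise R)) R :=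
  if N is n.+1 then distribution (noise_law \x noises_law n)%E (@tcons n)
  else \d_ [tuple].

End noises.

(* L_N(sigma, (0, m)) *)
Definition loss (R : realType) (D : R) (N M : nat)
    (nu1 : probability (measurableTypeR R) R) (sigma : strategy R) (m : R) :
    \bar R :=
  ((N%:R * Num.max 0 m)%:E - 'E_(noises_law D nu1 m N)
     [fun w => (\sum_(x <- incomes M sigma (history0 R) w) x)%R])%E.

Definition expected_loss (R : realType) (C D : R) (N M : nat)
    (nu1 : probability (measurableTypeR R) R) (lambda : R -> R)
    (sigma : strategy R) : \bar R :=
  (\int[lebesgue_measure]_(m in `[(- C)%R, C])
     (loss D N M nu1 sigma m * (lambda m)%:E))%E.

(* R^B_N(lambda); that the infimum is attained is not built in. *)
Definition bayes_risk (R : realType) (C D : R) (N M : nat)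
    (nu1 : probability (measurableTypeR R) R) (lambda : R -> R) : \bar R :=
  ereal_inf (range (expected_loss C D N M nu1 lambda)).

Definition prior_density (R : realType) (C : R) (lambda : R -> R) : Prop :=
  [/\ measurable_fun `[- C, C] lambda,
      forall m, m \in `[- C, C] -> 0 <= lambda m &
      (\int[lebesgue_measure]_(m in `[(- C)%R, C]) (lambda m)%:E = 1)%E].

Definition g1 (R : realType) (C D : R) (lambda : R -> R) (X : R) (n : nat) :
    \bar R :=
  (\int[lebesgue_measure]_(m in `[0%R, C])
     (m * lik D n X m * lambda m)%:E)%E.

Definition g2 (R : realType) (C D : R) (lambda : R -> R) (X : R) (n : nat) :
    \bar R :=
  (\int[lebesgue_measure]_(m in `[(- C)%R, 0%R])
     (`|m| * lik D n X m * lambda m)%:E)%E.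

(* Rt, Rt1, Rt2 stand for R~, R~_1, R~_2. Values outside of the stated domain
   of (k, X, n) are left unconstrained. *)
Definition dp_solution (R : realType) (C D : R) (N M : nat) (lambda : R -> R)
    (Rt Rt1 Rt2 : nat -> R -> nat -> \bar R) : Prop :=
  forall (k : nat) (X : R) (n : nat),
    (M %| k)%N -> (M %| n)%N -> (k + n <= N)%N -> (n = 0%N -> X = 0) ->
  [/\ Rt k X n = Order.min (Rt1 k X n) (Rt2 k X n),
      (k + n = N)%N -> Rt1 k X n = 0%E /\ Rt2 k X n = 0%E &
      (k + n < N)%N ->
        Rt1 k X n = (M%:R%:E * g1 C D lambda X n + Rt (k + M)%N X n)%E /\
        Rt2 k X n = (M%:R%:E * g2 C D lambda X n +
          \int[lebesgue_measure]_Y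
            (Rt k (X + Y)%R (n + M)%N *
             (hker D M n (M%:R * X - n%:R * Y))%:E))%E].

(* Backward recursion, with r the number of remaining batches *)
Fixpoint dp_rec (R : realType) (C D : R) (M : nat) (lambda : R -> R) (r k : nat)
    (X : R) (n : nat) : \bar R * \bar R :=
  if r is r'.+1 then
    let V k X n := let p := dp_rec C D M lambda r' k X n in
      Order.min p.1 p.2 in
    ((M%:R%:E * g1 C D lambda X n + V (k + M)%N X n)%E,
     (M%:R%:E * g2 C D lambda X n +
        \int[lebesgue_measure]_Y
          (V k (X + Y)%R (n + M)%N *
           (hker D M n (M%:R * X - n%:R * Y))%:E))%E)
  else (0%E, 0%E).

Lemma dp_solution_exists (R : realType) (C D : R) (N M : nat)
    (lambda : R -> R) : (0 < M)%N -> (M %| N)%N ->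
  exists Rt Rt1 Rt2, dp_solution C D N M lambda Rt Rt1 Rt2.
Proof.
move=> M0 MN.
pose p k X n := dp_rec C D M lambda ((N - (k + n)) %/ M) k X n.
exists (fun k X n => Order.min (p k X n).1 (p k X n).2).
exists (fun k X n => (p k X n).1), (fun k X n => (p k X n).2).
move=> k X n Mk Mn knN n0; split => //.
  by move=> knE; rewrite /p knE subnn div0n.
move=> knN'.
have Md : (M %| N - (k + n))%N by rewrite dvdn_sub// dvdn_add.
have E : ((N - (k + n)) %/ M = ((N - (k + n + M)) %/ M).+1)%N.
  have le : (M <= N - (k + n))%N by rewrite dvdn_leq// subn_gt0.
  by rewrite (subnDA (k + n)%N) -{1}(subnK le) divnDr ?dvdnn// divnn M0 addn1.
by rewrite /p E /= (addnAC k M n) (addnA k n M).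
Qed.

(* Main.v *)
Require Import Defs.
From HB Require Import structures.
From mathcomp Require Import all_boot all_order all_algebra.
From mathcomp Require Import all_classical all_reals all_analysis.
From mathcomp Require Import measurable_realfun ring lra zify.

Set Implicit Arguments.
Unset Strict Implicit.
Unset Printing Implicit Defensive.
Import Order.TTheory GRing.Theory Num.Theory.
Import numFieldNormedType.Exports.
Local Open Scope classical_set_scope.
Local Open Scope ring_scope.

(* Let W(k, X, n) be the loss of a strategy over the steps that remain at a
   history (k, X, n) with k and n multiples of M, integrated against
   f_{nD}(X|nm) lambda(m) dm, the unnormalized posterior of m.  The first batch
   from there costs M max(0, m) or M max(0, -m) and, if it is made with the
   second arm, adds to X a Gaussian income Y of mean Mm and variance MD.
   Completing the square,
     f_{nD}(X|nm) f_{MD}(Y|Mm) = f_{(n+M)D}(X+Y|(n+M)m) h_{n,M}(MX - nY),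
   so by Tonelli's theorem W satisfies the recursion of R~ with the minimum
   replaced by the convex combination that the strategy chooses.  Hence
   R~ <= W by backward induction, with equality for the strategy that always
   selects an arm attaining the minimum. *)

(** * Gaussian integrals *)

(** Incomes are signed, so exchanging integrals in their expectation requires integrability. The
    loss is therefore first rewritten with nonnegative costs: an income of mean 0 falls short of
    [Num.max 0 m] by [Num.max 0 m], one of mean [m] by [Num.max 0 (- m)]. This is where the law of
    the first arm drops out; all later exchanges are between nonnegative functions. The Gaussian [Y]
    of a batch is available because no selection depends on the incomes inside a batch: they can be
    summed first, and convolution makes their sum Gaussian. A solution of the equation is not
    assumed measurable, although integrals of it are compared. Measurability is extracted from the
    equation by backward induction, for [n > 0] only, since at [n = 0] the solution is constrained
    at [X = 0] alone. That is enough: the integral in the equation evaluates R~ at [n + M > 0]. *)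

Section lebesgue_reflection.
Context (R : realType).
Local Notation mu := (@lebesgue_measure R).
Local Open Scope ereal_scope.

Let refl (c x : measurableTypeR R) : measurableTypeR R := (c - x)%R.

Let mrefl c : measurable_fun setT (refl c).
Proof. by apply: measurable_funB => //; exact: measurable_cst. Qed.

Lemma lebesgue_measure_reflection (c : R) (A : set R) : measurable A ->
  pushforward mu (refl c) A = mu A.
Proof.
move=> mA; apply/esym/lebesgue_measure_unique => //= _ [[a b]] _ <-.
rewrite /pushforward.
rewrite (_ : refl c @^-1` _ = `[c - b, c - a[%classic)%R; last first.
  by apply/seteqP; split => x /=; rewrite /refl !in_itv/= => /andP[? ?];
    apply/andP; split; lra.
rewrite !lebesgue_measure_itv/= !lte_fin ltrD2l ltrN2.
by case: ifPn => // _; rewrite -!EFinB; congr EFin; lra.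
Qed.

Lemma ge0_integral_reflection (c : R) (f : R -> \bar R) :
  measurable_fun setT f -> (forall x, 0 <= f x) ->
  \int[mu]_x f (c - x)%R = \int[mu]_x f x.
Proof.
move=> mf f0.
transitivity (\int[pushforward mu (refl c)]_x f x).
  by rewrite ge0_integral_pushforward//; exact: mrefl.
by apply: eq_measure_integral => A mA _; exact: lebesgue_measure_reflection.
Qed.

(** A translation is the composition of two reflections. Reflections are taken as the basic maps
    because the mean of a normal law is computed from its symmetry. *)
Lemma ge0_integral_translation (c : R) (f : R -> \bar R) :
  measurable_fun setT f -> (forall x, 0 <= f x) ->
  \int[mu]_x f (c + x)%R = \int[mu]_x f x.
Proof.
move=> mf f0; rewrite -[RHS](ge0_integral_reflection c)//.
rewrite -[RHS](ge0_integral_reflection 0)//.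
- by apply: eq_integral => x _; rewrite sub0r opprK.
- by apply: measurableT_comp => //; exact: measurable_funB.
Qed.

End lebesgue_reflection.

Section normal_integral.
Context (R : realType) (a s : R).
Local Notation mu := (@lebesgue_measure R).
Local Open Scope ereal_scope.

(** The Radon-Nikodym derivative of the normal law equals [normal_pdf] almost everywhere, both
    having the same integral over every measurable set. *)
Lemma ge0_integral_normal_prob (f : R -> \bar R) :
  measurable_fun setT f -> (forall x, 0 <= f x) ->
  \int[normal_prob a s]_x f x = \int[mu]_x (f x * (normal_pdf a s x)%:E).
Proof.
move=> mf f0.
have dom := normal_prob_dominates a s.
rewrite -(Radon_Nikodym_SigmaFinite.change_of_variables dom)//.
have mpdf : measurable_fun setT (EFin \o normal_pdf a s).
  by apply/measurable_EFinP; exact: measurable_normal_pdf.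
have irn := Radon_Nikodym_SigmaFinite.f_integrable dom.
apply: ge0_ae_eq_integral => //.
- by apply: emeasurable_funM => //; exact: measurable_int irn.
- exact: emeasurable_funM.
- by move=> x _; rewrite mule_ge0// Radon_Nikodym_SigmaFinite.f_ge0.
- by move=> x _; rewrite mule_ge0// lee_fin normal_pdf_ge0.
- apply: ae_eqe_mul2l; apply: integral_ae_eq => //.
  by move=> E _ mE; rewrite -Radon_Nikodym_SigmaFinite.f_integral.
Qed.

End normal_integral.

Section gaussian_density.
Context (R : realType).
Local Notation mu := (@lebesgue_measure R).
Implicit Types (V D a m x X Y : R) (n M : nat).

Lemma gaussE V a x : 0 < V ->
  gauss V a x = (Num.sqrt (2 * pi * V))^-1 * expR (- (x - a) ^+ 2 / (2 * V)).
Proof.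
move=> V0; rewrite /gauss normal_pdfE ?gt_eqF ?sqrtr_gt0//.
rewrite /normal_peak /normal_fun !sqr_sqrtr ?ltW//.
by congr (_ * expR (_ / _)); [congr ((Num.sqrt _)^-1); ring|ring].
Qed.

Lemma gauss_ge0 V a x : 0 <= gauss V a x.
Proof. exact: normal_pdf_ge0. Qed.

Lemma integral_gauss V a : (\int[mu]_x (gauss V a x)%:E = 1)%E.
Proof. exact: integral_normal_pdf. Qed.

Lemma measurable_gauss d (T : measurableType d) V (a x : T -> R) : 0 < V ->
  measurable_fun setT a -> measurable_fun setT x ->
  measurable_fun setT (fun t => gauss V (a t) (x t)).
Proof.
move=> V0 ma mx; under eq_fun do rewrite gaussE//.
apply: measurable_funM => //; apply: measurableT_comp => //.
apply: measurable_funM => //; apply: measurableT_comp => //.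
by apply: measurable_funX; exact: measurable_funB.
Qed.

Lemma lik_ge0 D n X m : 0 <= lik D n X m.
Proof. by rewrite /lik; case: ifPn => // _; exact: gauss_ge0. Qed.

Lemma hker_ge0 D M n Y : 0 <= hker D M n Y.
Proof. by rewrite /hker; case: ifPn => // _; rewrite mulr_ge0// gauss_ge0. Qed.

Lemma measurable_lik d (T : measurableType d) D n (X m : T -> R) : 0 < D ->
  measurable_fun setT X -> measurable_fun setT m ->
  measurable_fun setT (fun t => lik D n (X t) (m t)).
Proof.
move=> D0 mX mm; rewrite /lik; have [_|n0] := eqVneq n 0%N; first exact: measurable_cst.
apply: measurable_gauss => //;
  [by rewrite mulr_gt0// ltr0n lt0n|exact: measurable_funM].
Qed.

Lemma measurable_hker d (T : measurableType d) D M n (Y : T -> R) :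
  0 < D -> (0 < M)%N ->
  measurable_fun setT Y -> measurable_fun setT (fun t => hker D M n (Y t)).
Proof.
move=> D0 M0 mY; rewrite /hker; have [_|n0] := eqVneq n 0%N; first exact: measurable_cst.
apply: measurable_funM => //; apply: measurable_gauss => //.
by rewrite !mulr_gt0// ltr0n ?addn_gt0 ?M0 ?orbT// lt0n.
Qed.

(* Completing the square: h_{n,M} is the factor by which the product of the
   densities of two independent Gaussian sums exceeds the density of their
   total. *)
Lemma lik_mul_gauss D n M X Y m : 0 < D -> (0 < M)%N -> (n = 0%N -> X = 0) ->
  lik D n X m * gauss (M%:R * D) (M%:R * m) Y =
  lik D (n + M) (X + Y) m * hker D M n (M%:R * X - n%:R * Y).
Proof.
move=> D0 M0; rewrite /lik /hker addn_eq0 (gtn_eqF M0) andbF.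
have [-> -> //|n0 _] := eqVneq n 0%N; first by rewrite !add0r add0n mul1r mulr1.
have n0' : 0 < n%:R :> R by rewrite ltr0n lt0n.
have M0' : 0 < M%:R :> R by rewrite ltr0n.
rewrite natrD; set N := n%:R : R in n0' *; set K := M%:R : R in M0' *.
have NK0 : 0 < N + K by rewrite addr_gt0.
have p0 := pi_gt0 R.
rewrite !gaussE ?mulr_gt0// mulrACA [X in _ = _ * X]mulrA [RHS]mulrACA.
rewrite -!expRD; congr (_ * expR _); last first.
  by field; rewrite ?gt_eqF.
rewrite [RHS]mulrCA -!invfM -!sqrtrM ?mulr_ge0 ?ltW//.
rewrite [X in _ = _ / Num.sqrt X](_ : _ =
  (N + K) ^+ 2 * (2 * pi * (N * D) * (2 * pi * (K * D)))); last by ring.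
rewrite [in RHS]sqrtrM ?sqr_ge0// sqrtr_sqr gtr0_norm// invfM.
by rewrite mulVKf ?gt_eqF.
Qed.

(** For [c = n z] this is the conditional density of the sum of the first [n] incomes given that the
    total of [n + M] incomes is [z]: Gaussian with mean [n z / (n + M)] and variance
    [n M D / (n + M)]. *)
Lemma integral_hker D M n (c : R) : 0 < D -> (0 < M)%N -> (0 < n)%N ->
  (\int[mu]_x (hker D M n ((n + M)%:R * x - c))%:E = 1)%E.
Proof.
move=> D0 M0 n0.
rewrite -(integral_gauss (n%:R * M%:R * D / (n + M)%:R) (c / (n + M)%:R)).
have n0' : 0 < n%:R :> R by rewrite ltr0n.
have M0' : 0 < M%:R :> R by rewrite ltr0n.
apply: eq_integral => x _; congr EFin; rewrite /hker (gtn_eqF n0) natrD.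
set N := n%:R : R in n0' *; set K := M%:R : R in M0' *.
have NK0 : 0 < N + K by rewrite addr_gt0.
have p0 := pi_gt0 R.
rewrite !gaussE ?divr_gt0 ?mulr_gt0// [LHS]mulrA; congr (_ * expR _); last first.
  by field; rewrite ?gt_eqF.
(* The square pulled out of the root cancels the factor [n + M] in [hker]. *)
rewrite [X in _ / Num.sqrt X = _](_ : _ =
  (N + K) ^+ 2 * (2 * pi * (N * K * D / (N + K)))); last by field; rewrite gt_eqF.
rewrite sqrtrM ?sqr_ge0// sqrtr_sqr gtr0_norm// invfM.
by rewrite mulVKf ?gt_eqF.
Qed.

Local Open Scope ereal_scope.

(** Completing the square serves here too: after the substitution [z = x + y] the product of the two
    densities is the density of [z] times a kernel in [x] of integral 1. *)
Lemma gauss_convolution D n M m (f : R -> \bar R) :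
  (0 < D)%R -> (0 < n)%N -> (0 < M)%N ->
  measurable_fun setT f -> (forall x, 0 <= f x) ->
  \int[mu]_x (\int[mu]_y (f (x + y)%R * (gauss (M%:R * D) (M%:R * m) y)%:E) *
              (gauss (n%:R * D) (n%:R * m) x)%:E) =
  \int[mu]_z (f z * (gauss ((n + M)%:R * D) ((n + M)%:R * m) z)%:E).
Proof.
move=> D0 n0 M0 mf f0.
have nD0 : (0 < n%:R * D)%R by rewrite mulr_gt0// ltr0n.
have MD0 : (0 < M%:R * D)%R by rewrite mulr_gt0// ltr0n.
have nMD0 : (0 < (n + M)%:R * D)%R by rewrite mulr_gt0// ltr0n addn_gt0 n0.
pose F (p : measurableTypeR R * measurableTypeR R) := f p.2 *
  (gauss (M%:R * D) (M%:R * m) (p.2 - p.1) * gauss (n%:R * D) (n%:R * m) p.1)%:E.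
have mF : measurable_fun setT F.
  apply: emeasurable_funM; first exact: measurableT_comp.
  apply/measurable_EFinP/measurable_funM; apply: measurable_gauss => //.
  exact: measurable_funB.
have F0 p : 0 <= F p by rewrite mule_ge0// lee_fin mulr_ge0// gauss_ge0.
transitivity (\int[mu]_x \int[mu]_z F (x, z)).
  apply: eq_integral => x _.
  rewrite -(@ge0_integral_translation _ x (fun z => F (x, z)))//; last first.
    exact: measurableT_comp.
  rewrite -ge0_integralZr//=.
  - apply: eq_integral => y _; rewrite /F/= -muleA -EFinM.
    by rewrite addrAC subrr add0r.
  - apply: emeasurable_funM.
      by apply: measurableT_comp => //; exact: measurable_funD.
    by apply/measurable_EFinP/measurable_gauss.
  - by move=> y _; rewrite mule_ge0// lee_fin gauss_ge0.
  - by rewrite lee_fin gauss_ge0.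
rewrite (fubini_tonelli F)//; apply: eq_integral => z _.
under eq_integral => x _.
  rewrite /F/= (_ : (_ * _)%R =
    (gauss ((n + M)%:R * D) ((n + M)%:R * m) z *
     hker D M n ((n + M)%:R * x - n%:R * z))%R); last first.
    have := @lik_mul_gauss D n M x (z - x) m D0 M0.
    rewrite /lik addn_eq0 (gtn_eqF n0) (addrC x) subrK mulrC => -> //; last first.
      by move=> n00; rewrite n00 in n0.
    by congr (_ * hker _ _ _ _)%R; rewrite natrD; ring.
  rewrite EFinM muleA.
  over.
rewrite /= ge0_integralZl//.
- by rewrite integral_hker// mule1.
- apply/measurable_EFinP/measurable_hker => //.
  by apply: measurable_funB => //; exact: measurable_funM.
- by move=> x _; rewrite lee_fin hker_ge0.
- by rewrite mule_ge0// lee_fin gauss_ge0.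
Qed.

End gaussian_density.

(** * Expected loss as a recursion *)

Section regret.
Context (R : realType) (D : R) (M : nat) (sigma : strategy R).
Local Notation mu := (@lebesgue_measure R).

Definition prob_arm1 (s : history R) : R :=
  if (M %| napp1 s)%N && (M %| napp2 s)%N
  then select sigma (napp1 s) (income2 s) (napp2 s)
  else if last_action s is arm1 then 1 else 0.

(* The expected loss over the next [j] steps: relative to the better arm, the
   first arm loses [max 0 m] per application and the second [max 0 (- m)]. *)
Fixpoint regret (m : R) (j : nat) (s : history R) : \bar R :=
  if j is i.+1 then
    ((prob_arm1 s)%:E *
       ((Num.max 0 m)%:E + regret m i (update s arm1 0%R)) +
     (1 - prob_arm1 s)%:E *
       ((Num.max 0 (- m))%:E +
        \int[mu]_y (regret m i (update s arm2 y) * (gauss D m y)%:E)))%E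
  else 0%E.

(** One forced application of the second arm, as an operator on functions of the income, so that the
    forced steps of a batch become an iterate. *)
Definition pull2 (m : R) (f : R -> \bar R) (X : R) : \bar R :=
  ((Num.max 0 (- m))%:E + \int[mu]_y (f (X + y)%R * (gauss D m y)%:E))%E.

Hypothesis D0 : 0 < D.

Lemma prob_arm1_01 s : 0 <= prob_arm1 s <= 1.
Proof.
rewrite /prob_arm1; case: ifP => _; first exact: select_prob.
by case: (last_action s); rewrite ?lexx ?ler01.
Qed.

Lemma prob_arm1_ge0 s : 0 <= prob_arm1 s.
Proof. by case/andP: (prob_arm1_01 s). Qed.

Lemma prob_arm1C_ge0 s : 0 <= 1 - prob_arm1 s.
Proof. by rewrite subr_ge0; case/andP: (prob_arm1_01 s). Qed.

Lemma measurable_prob_arm1 k n a :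
  measurable_fun setT (fun X => prob_arm1 (History k X n a)).
Proof.
rewrite /prob_arm1/=; have [_|_] := boolP (_ && _); last exact: measurable_cst.
exact: select_measurable.
Qed.

Local Open Scope ereal_scope.

Lemma regret_ge0 m j s : 0 <= regret m j s.
Proof.
elim: j s => //= j IH s; rewrite adde_ge0// mule_ge0//.
- by rewrite lee_fin prob_arm1_ge0.
- by rewrite adde_ge0// lee_fin le_max lexx.
- by rewrite lee_fin prob_arm1C_ge0.
- rewrite adde_ge0// ?lee_fin ?le_max ?lexx//.
  by apply: integral_ge0 => y _; rewrite mule_ge0// lee_fin gauss_ge0.
Qed.

(** Measurability is joint in [(m, X)] because integrals over [m] and over incomes are exchanged
    later. *)
Lemma measurable_regret j k n a : measurable_fun setT
  (fun p : measurableTypeR R * measurableTypeR R =>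
     regret p.1 j (History k p.2 n a)).
Proof.
elim: j k n a => /= [|j IH] k n a; first exact: measurable_cst.
have mp : measurable_fun setT (fun p : measurableTypeR R * measurableTypeR R =>
    prob_arm1 (History k p.2 n a)).
  exact: (measurableT_comp (measurable_prob_arm1 k n a)).
apply: emeasurable_funD; apply: emeasurable_funM.
- exact/measurable_EFinP.
- apply: emeasurable_funD; last exact: IH.
  by apply/measurable_EFinP; apply: measurable_maxr.
- by apply/measurable_EFinP; apply: measurable_funB.
- apply: emeasurable_funD.
    by apply/measurable_EFinP; apply: measurable_maxr => //; exact: measurableT_comp.
  apply: (@measurable_fun_fubini_tonelli_F _ _ _ _ _ _
    (fun q : (measurableTypeR R * measurableTypeR R) * measurableTypeR R =>
     regret q.1.1 j (History k (q.1.2 + q.2)%R n.+1 arm2) *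
       (gauss D q.1.1 q.2)%:E)) => [|q].
    apply: emeasurable_funM.
      have mq : measurable_fun setT
          (fun q : (measurableTypeR R * measurableTypeR R) * measurableTypeR R =>
           (q.1.1, q.1.2 + q.2)%R : measurableTypeR R * measurableTypeR R).
        apply/measurable_fun_pair => /=; first exact: measurableT_comp.
        by apply: measurable_funD => //; exact: measurableT_comp.
      exact: (measurableT_comp (IH k n.+1 arm2) mq).
    by apply/measurable_EFinP/measurable_gauss => //; exact: measurableT_comp.
  by rewrite mule_ge0 ?regret_ge0// lee_fin gauss_ge0.
Qed.

Lemma measurable_regret_income m j k n a :
  measurable_fun setT (fun X => regret m j (History k X n a)).
Proof.
have mX : measurable_fun setT
    (fun X => (m, X) : measurableTypeR R * measurableTypeR R).
  exact: measurable_fun_pair.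
exact: (measurableT_comp (measurable_regret j k n a) mX).
Qed.

Lemma integral_gauss_affine (V a c : R) (f : R -> \bar R) :
  (0 < V)%R -> (0 <= c)%R -> measurable_fun setT f -> (forall x, 0 <= f x) ->
  \int[mu]_y ((c%:E + f y) * (gauss V a y)%:E) =
  c%:E + \int[mu]_y (f y * (gauss V a y)%:E).
Proof.
move=> V0 c0 mf f0.
have mg : measurable_fun setT (fun y => (gauss V a y)%:E).
  by apply/measurable_EFinP/measurable_gauss.
under eq_integral do rewrite ge0_muleDl//.
rewrite ge0_integralD//=.
- by rewrite ge0_integralZl// ?integral_gauss ?mule1// => y _; rewrite lee_fin gauss_ge0.
- by move=> y _; rewrite mule_ge0 ?lee_fin ?gauss_ge0.
- by apply: emeasurable_funM.
- by move=> y _; rewrite mule_ge0 ?lee_fin ?gauss_ge0.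
- exact: emeasurable_funM.
Qed.

(** Either arm costs at most [|m|] per step. The bound makes the regret finite and integrable in the
    income, so that it can be subtracted in [integral_incomes]. *)
Lemma regret_le m j s : regret m j s <= (j%:R * `|m|)%:E.
Proof.
elim: j s => [|j IH] s /=; first by rewrite mul0r.
have h1 : (Num.max 0 m)%:E + regret m j (update s arm1 0%R) <= (j.+1%:R * `|m|)%:E.
  rewrite -addn1 natrD mulrDl mul1r addrC EFinD leeD// lee_fin.
  by rewrite ge_max normr_ge0 ler_norm.
have h2 : (Num.max 0 (- m))%:E +
    \int[mu]_y (regret m j (update s arm2 y) * (gauss D m y)%:E)
    <= (j.+1%:R * `|m|)%:E.
  rewrite -addn1 natrD mulrDl mul1r addrC EFinD; apply: leeD; last first.
    by rewrite lee_fin ge_max normr_ge0/= -normrN ler_norm.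
  apply: (@le_trans _ _ (\int[mu]_y ((j%:R * `|m|)%:E * (gauss D m y)%:E))).
    apply: ge0_le_integral => //=.
    - by move=> y _; rewrite mule_ge0 ?regret_ge0 ?lee_fin ?gauss_ge0.
    - apply: emeasurable_funM; last by apply/measurable_EFinP/measurable_gauss.
      case: s {h1} => k X n a.
      apply: (measurableT_comp (measurable_regret_income m j k n.+1 arm2)).
      exact: measurable_funD.
    - apply: emeasurable_funM; first exact: measurable_cst.
      by apply/measurable_EFinP/measurable_gauss.
    - by move=> y _; rewrite lee_wpmul2r ?lee_fin ?gauss_ge0.
  rewrite ge0_integralZl//= ?integral_gauss ?mule1//.
  - by apply/measurable_EFinP/measurable_gauss.
  - by move=> y _; rewrite lee_fin gauss_ge0.
have -> : (j.+1%:R * `|m|)%:E = (prob_arm1 s)%:E * (j.+1%:R * `|m|)%:E +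
    (1 - prob_arm1 s)%:E * (j.+1%:R * `|m|)%:E.
  by rewrite -!EFinM -EFinD; congr EFin; ring.
by rewrite leeD// lee_wpmul2l ?lee_fin ?prob_arm1_ge0 ?prob_arm1C_ge0.
Qed.

(** Convolution merges the successive incomes into one Gaussian. The count starts at 1, as an empty
    sum of incomes has no density. *)
Lemma iter_pull2 m f i X : measurable_fun setT f -> (forall x, 0 <= f x) ->
  iter i.+1 (pull2 m) f X = (i.+1%:R * Num.max 0 (- m))%:E +
    \int[mu]_y (f (X + y)%R * (gauss (i.+1%:R * D) (i.+1%:R * m) y)%:E).
Proof.
move=> mf f0; elim: i X => [|i IH] X.
  by rewrite /= /pull2; under [in RHS]eq_integral do rewrite !mul1r; rewrite mul1r.
rewrite iterS [LHS]/pull2.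
under eq_integral do rewrite IH.
have i0 : (0 < i.+1%:R * D)%R by rewrite mulr_gt0// ltr0n.
have mfX : measurable_fun setT (fun z => f (X + z)%R).
  by apply: (measurableT_comp mf); exact: measurable_funD.
rewrite integral_gauss_affine//.
- have := @gauss_convolution R D 1 i.+1 m (fun z => f (X + z)%R) D0 isT isT mfX
    (fun z => f0 (X + z)%R).
  rewrite !mul1r add1n => <-; rewrite addeA -EFinD; apply: (f_equal2 adde).
    by congr EFin; rewrite -[in RHS]addn1 natrD; ring.
  by apply: eq_integral => x _; under eq_integral do rewrite -addrA.
- by rewrite mulr_ge0// le_max lexx.
- apply: (@measurable_fun_fubini_tonelli_F _ _ _ _ _ _
    (fun q : measurableTypeR R * measurableTypeR R =>
     f (X + q.1 + q.2)%R * (gauss (i.+1%:R * D) (i.+1%:R * m) q.2)%:E)) => [|q].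
    apply: emeasurable_funM.
      apply: (measurableT_comp mf).
      by apply: measurable_funD => //; exact: measurable_funD.
    by apply/measurable_EFinP/measurable_gauss.
  by rewrite mule_ge0// lee_fin gauss_ge0.
- by move=> y; apply: integral_ge0 => z _; rewrite mule_ge0// lee_fin gauss_ge0.
Qed.

(** Here [0 < d < M]: strictly inside a batch, the count of the arm in use is not a multiple of [M],
    so the test for a new selection fails. *)
Let forced k n i d : (0 < d)%N -> (i.+1 + d = M)%N ->
  (M %| k)%N -> (M %| n)%N -> ~~ (M %| k + d)%N /\ ~~ (M %| n + d)%N.
Proof.
move=> d0 idM Mk Mn; rewrite !dvdn_addr// gtnNdvd// -idM.
by rewrite addSn ltnS leq_addl.
Qed.

(** The batch has [d] steps behind it and [i] ahead; [0 < d] excludes the step at which the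
    selection is made. *)
Lemma regret_batch_arm1 m j k n X i d : (0 < d)%N -> (i + d = M)%N ->
  (M %| k)%N -> (M %| n)%N ->
  regret m (i + j) (History (k + d) X n arm1) =
  (i%:R * Num.max 0 m)%:E + regret m j (History (k + M) X n arm1).
Proof.
move=> + + Mk Mn; elim: i d => [|i IH] d d0 idM.
  by rewrite mul0r add0e -[d]add0n idM.
rewrite addSn /= /prob_arm1/= (negbTE (forced d0 idM Mk Mn).1)/=.
rewrite subrr mul0e adde0 mul1e /update/= -addnS IH//; last by rewrite addnS -idM.
by rewrite addeA -EFinD; congr (_%:E + _); rewrite -[in RHS]addn1 natrD; ring.
Qed.

Lemma regret_batch_arm2 m j k n X i d : (0 < d)%N -> (i + d = M)%N ->
  (M %| k)%N -> (M %| n)%N ->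
  regret m (i + j) (History k X (n + d) arm2) =
  iter i (pull2 m) (fun X => regret m j (History k X (n + M) arm2)) X.
Proof.
move=> + + Mk Mn; elim: i d X => [|i IH] d X d0 idM.
  by rewrite /= -[d]add0n idM.
rewrite addSn /= /prob_arm1/= (negbTE (forced d0 idM Mk Mn).2) andbF/=.
rewrite mul0e add0e subr0 mul1e /update/= -addnS; congr (_ + _).
by apply: eq_integral => y _; rewrite IH// addnS -idM.
Qed.

Lemma regret_batch m j k n X a : (0 < M)%N -> (M %| k)%N -> (M %| n)%N ->
  regret m (M + j) (History k X n a) =
  (select sigma k X n)%:E * ((M%:R * Num.max 0 m)%:E +
     regret m j (History (k + M) X n arm1)) +
  (1 - select sigma k X n)%:E * ((M%:R * Num.max 0 (- m))%:E +
     \int[mu]_y (regret m j (History k (X + y)%R (n + M) arm2) *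
       (gauss (M%:R * D) (M%:R * m) y)%:E)).
Proof.
move=> M0 Mk Mn; have [i iM] : exists i, (i + 1 = M)%N by exists M.-1; rewrite addn1 prednK.
rewrite -[in LHS]iM addn1 addSn /= /prob_arm1/= Mk Mn/=.
apply: (f_equal2 adde); apply: (f_equal2 mule) (erefl _) _.
  rewrite /update/= -addn1 (@regret_batch_arm1 _ _ _ _ _ i 1)//.
  by rewrite addeA -EFinD; congr (_%:E + _); rewrite -iM natrD; ring.
have mr : measurable_fun setT (fun X => regret m j (History k X (n + M) arm2)).
  exact: measurable_regret_income.
(* The step at which the second arm is selected is itself a [pull2]; with the [i] forced ones this
   makes [M]. *)
transitivity (iter i.+1 (pull2 m) (fun X => regret m j (History k X (n + M) arm2)) X).
  rewrite iterS /pull2; congr (_ + _); apply: eq_integral => y _.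
  by rewrite /update/= -addn1 (@regret_batch_arm2 _ _ _ _ _ i 1).
have r0 x : 0 <= regret m j (History k x (n + M) arm2) by exact: regret_ge0.
rewrite (iter_pull2 m i X mr r0) (_ : i.+1 = M)//.
by rewrite -addn1.
Qed.

End regret.

(** * Integrability and mean of the normal law *)

Section normal_mean.
Context (R : realType) (V a : R) (V0 : 0 < V).
Local Notation mu := (@lebesgue_measure R).
Local Notation P := (normal_prob a (Num.sqrt V)).
Local Open Scope ereal_scope.

Let integral_gaussian (f : R -> \bar R) :
  measurable_fun setT f -> (forall x, 0 <= f x) ->
  \int[P]_x f x = \int[mu]_x (f x * (gauss V a x)%:E).
Proof. exact: ge0_integral_normal_prob. Qed.

Let mgauss : measurable_fun setT (fun x => (gauss V a x)%:E).
Proof. by apply/measurable_EFinP/measurable_gauss. Qed.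

(** Exponential tilting: the factor [expR (t * x)] moves the mean from [a] to [a + t * V], at the
    price of the constant [expR (t * a + t ^+ 2 * V / 2)]. *)
Lemma normal_mgf_lty (t : R) : \int[P]_x (expR (t * x))%:E < +oo.
Proof.
have me : measurable_fun setT (fun x : R => (expR (t * x))%:E).
  by apply/measurable_EFinP; apply: measurableT_comp.
rewrite integral_gaussian//.
have -> : \int[mu]_x ((expR (t * x))%:E * (gauss V a x)%:E) =
    \int[mu]_x ((expR (t * a + t ^+ 2 * V / 2))%:E * (gauss V (a + t * V)%R x)%:E).
  apply: eq_integral => x _; rewrite -!EFinM !gaussE//; congr EFin.
  rewrite mulrCA [RHS]mulrCA -!expRD; congr (_ * expR _)%R.
  by field; rewrite gt_eqF.
rewrite ge0_integralZl//=.
- by rewrite integral_gauss mule1 ltry.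
- by apply/measurable_EFinP/measurable_gauss.
- by move=> x _; rewrite lee_fin gauss_ge0.
Qed.

(** [|x|] is dominated by [expR x + expR (- x)], by [1 + y <= expR y] at [y = x] and [y = - x]. *)
Lemma normal_id_integrable : P.-integrable setT (fun x : R => x%:E).
Proof.
apply/integrableP; split; first exact/measurable_EFinP.
pose g t (x : R) := (expR (t * x))%:E : \bar R.
have mg t : measurable_fun setT (g t).
  by apply/measurable_EFinP; apply: measurableT_comp.
have g0 t x : 0 <= g t x by rewrite lee_fin expR_ge0.
apply: (@le_lt_trans _ _ (\int[P]_x (g 1%R x + g (-1)%R x))).
  apply: ge0_le_integral => //=.
  - by apply: measurableT_comp => //; exact/measurable_EFinP.
  - by apply: emeasurable_funD; exact: mg.
  - move=> x _; rewrite -EFinD lee_fin mul1r mulN1r.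
    have e1 := expR_ge1Dx x; have e2 := expR_ge1Dx (- x).
    have := expR_ge0 x; have := expR_ge0 (- x).
    by case: (ger0P x) => _; lra.
rewrite ge0_integralD//; last 2 first.
- exact: mg.
- exact: mg.
by rewrite lte_add_pinfty// normal_mgf_lty.
Qed.

(** The reflection of [x] to [2 * a - x] preserves the density and exchanges the positive and
    negative parts of [x - a]. *)
Lemma integral_normal_id : \int[P]_x x%:E = a%:E.
Proof.
have ic : P.-integrable setT (fun x : R => (x - a)%:E).
  rewrite (_ : (fun x => _) = (fun x : R => x%:E) \- (EFin \o cst a))//.
  apply: integrableB => //; first exact: normal_id_integrable.
  exact: finite_measure_integrable_cst.
have mc : measurable_fun setT (fun x : R => (x - a)%:E).
  exact: measurable_int ic.
have c0 : \int[P]_x (x - a)%:E = 0.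
  have fin : \int[P]_x (fun x : R => (x - a)%:E)^\+ x \is a fin_num.
    exact: integrable_pos_fin_num.
  suff pn : \int[P]_x (fun x : R => (x - a)%:E)^\- x =
      \int[P]_x (fun x : R => (x - a)%:E)^\+ x by rewrite integralE pn subee.
  have mpos := measurable_funepos mc; have mneg := measurable_funeneg mc.
  rewrite !integral_gaussian//.
  rewrite -[LHS](@ge0_integral_reflection _ (2 * a)%R); last 2 first.
  - exact: emeasurable_funM.
  - by move=> x; rewrite mule_ge0// lee_fin gauss_ge0.
  apply: eq_integral => x _; rewrite funeposE funenegE -EFinN.
  have -> : (- (2 * a - x - a) = x - a)%R by ring.
  by rewrite !gaussE// (_ : (2 * a - x - a) ^+ 2 = (x - a) ^+ 2)%R//; ring.
have -> : \int[P]_x x%:E = \int[P]_x ((x - a)%:E + (cst a x)%:E).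
  by apply: eq_integral => x _; rewrite -EFinD subrK.
rewrite integralD//; last exact: finite_measure_integrable_cst.
rewrite c0 add0e (integral_cst P measurableT a%:E).
by rewrite /= probability_setT mule1.
Qed.

End normal_mean.

(** * One step: product laws and the randomized selection *)

Section product_integrable.
Context d1 d2 (T1 : measurableType d1) (T2 : measurableType d2) (R : realType).
Context (P1 : probability T1 R) (P2 : probability T2 R).
Local Open Scope ereal_scope.

Lemma integrable_fst (f : T1 -> \bar R) : P1.-integrable setT f ->
  (P1 \x P2).-integrable setT (fun p => f p.1).
Proof.
move=> /integrableP[mf foo]; apply/integrable12ltyP.
  exact: (measurableT_comp mf).
under eq_integral => x _.
  rewrite /= (integral_cst P2 measurableT `|f x|) /= probability_setT mule1.
  over.
exact: foo.
Qed.

Lemma integrable_snd (f : T2 -> \bar R) : P2.-integrable setT f ->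
  (P1 \x P2).-integrable setT (fun p => f p.2).
Proof.
move=> /integrableP[mf foo]; apply/integrable12ltyP.
  exact: (measurableT_comp mf).
rewrite (integral_cst P1 measurableT (\int[P2]_y `|f y|)) /=.
by rewrite probability_setT mule1.
Qed.

End product_integrable.

(** A boolean test, since [action] carries no measurable structure. *)
Definition is_arm1 (a : action) : bool := if a is arm1 then true else false.

Section expected_income.
Context (R : realType) (M : nat) (sigma : strategy R).
Local Notation U := (uniform_prob (@ltr01 R)).

Lemma next_actionE (s : history R) (w : noise R) :
  is_arm1 (next_action M sigma s w) =
  if (M %| napp1 s)%N && (M %| napp2 s)%N
  then w.1.1 < select sigma (napp1 s) (income2 s) (napp2 s)
  else is_arm1 (last_action s).
Proof. by rewrite /next_action; do 2 case: ifP => //. Qed.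

Lemma measurable_next_action d (T : measurableType d) k n a
    (X : T -> measurableTypeR R) (w : T -> noise R) :
  measurable_fun setT X -> measurable_fun setT w ->
  measurable_fun setT
    (fun t => is_arm1 (next_action M sigma (History k (X t) n a) (w t))).
Proof.
move=> mX mw; under eq_fun do rewrite next_actionE/=.
have [_|_] := boolP (_ && _); last exact: measurable_cst.
apply: measurable_fun_ltr.
  by do 2 apply: measurableT_comp => //.
exact: (measurableT_comp (select_measurable sigma k n)).
Qed.

Local Open Scope ereal_scope.

(** The action depends on the noise through its uniform component only, so the two incomes can be
    frozen at 0. *)
Lemma uniform_next_action (s : history R) :
  U [set u | is_arm1 (next_action M sigma s ((u, 0%R), 0%R))] =
  (prob_arm1 M sigma s)%:E.
Proof.
under eq_set do rewrite next_actionE/=.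
rewrite /prob_arm1; have [_|_] := boolP (_ && _); last first.
  case: (last_action s); first by rewrite set_true probability_setT.
  by rewrite set_false measure0.
set p := select _ _ _ _; have /andP[p0 p1] : (0 <= p <= 1)%R by exact: select_prob.
rewrite (_ : [set u | _] = `]-oo, p[%classic); last first.
  by apply/seteqP; split => u /=; rewrite in_itv.
rewrite /uniform_prob integral_uniform_pdf.
rewrite (_ : _ `&` _ = `[0%R, p[%classic); last first.
  apply/seteqP; split => u /=; rewrite !in_itv/=.
    by move=> [-> /andP[-> _]].
  by move=> /andP[-> up]; rewrite up (le_trans (ltW up)).
rewrite (eq_integral (cst 1)); last first.
  move=> u; rewrite inE/= in_itv/= => /andP[u0 up].
  by rewrite /uniform_pdf u0 (le_trans (ltW up))// subr0 invr1.
rewrite integral_cst//= mul1e lebesgue_measure_itv/= lte_fin.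
(* The formula for the length of an interval tests [0 < p]; for [p = 0] the interval is empty. *)
by move: p0; rewrite le_eqVlt => /predU1P[<-|->]; rewrite ?ltxx ?oppr0 ?adde0.
Qed.

Lemma integral_uniform_action (s : history R) (A B : R) :
  \int[U]_u
     (if is_arm1 (next_action M sigma s ((u, 0%R), 0%R)) then A else B)%:E =
  (prob_arm1 M sigma s * A + (1 - prob_arm1 M sigma s) * B)%:E.
Proof.
set S := [set u | is_arm1 (next_action M sigma s ((u, 0%R), 0%R))].
have mS : measurable (S : set (measurableTypeR R)).
  case: s @S => k X n a S; rewrite -[S]setTI.
  apply: (@measurable_next_action _ (measurableTypeR R) k n a (cst X)
    (fun u => ((u, 0%R), 0%R))) => //.
  by do 2 apply: measurable_fun_pair => //.
(* The conditional is written as [B + (A - B) * \1_S] to make it linear in an indicator. *)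
have -> : \int[U]_u (if is_arm1 (next_action M sigma s ((u, 0%R), 0%R)) then A
    else B)%:E = \int[U]_u ((EFin \o cst B) u + (A - B)%:E * (\1_S u)%:E).
  apply: eq_integral => u _; rewrite indicE -EFinM -EFinD; congr EFin.
  have [Su|nSu] := pselect (S u).
    by rewrite mem_set// (_ : is_arm1 _)// mulr1 addrC subrK.
  by rewrite memNset// (negbTE (introN idP nSu)) mulr0 addr0.
have i1 : (U : measure _ _).-integrable setT (fun u => (\1_S u)%:E).
  exact: integrable_indic.
rewrite integralD//; last 2 first.
- exact: finite_measure_integrable_cst.
- exact: integrableZl.
rewrite integralZl// integral_indic// setIT.
rewrite (integral_cst (U : measure _ _) measurableT B%:E) /=.
rewrite [X in _ * X + _](@probability_setT _ _ _ U) mule1.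
rewrite [X in _ + _ * X]uniform_next_action -EFinM -EFinD; congr EFin; ring.
Qed.

End expected_income.

(** * From expected incomes to the regret *)

Section loss_regret.
Context (R : realType) (D : R) (D0 : 0 < D) (M : nat) (sigma : strategy R).
Context (nu1 : probability (measurableTypeR R) R).
Hypothesis nu1_integrable : nu1.-integrable setT (fun x : R => x%:E).
Hypothesis nu1_mean : ('E_nu1[fun x : R => x] = 0)%E.
Context (m : R).
Local Notation mu := (@lebesgue_measure R).
Local Notation U := (uniform_prob (@ltr01 R)).
Local Notation N := (normal_prob m (Num.sqrt D)).
Local Notation Q := (noise_law D nu1 m).
Local Notation Qs := (noises_law D nu1 m).
Local Open Scope ereal_scope.

Lemma integrable_noise1 (h : R -> \bar R) : nu1.-integrable setT h ->
  Q.-integrable setT (fun w => h w.1.2).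
Proof.
move=> ih.
apply: (@integrable_fst _ _ _ _ _ (U \x nu1 : probability _ _) N
  (fun p => h p.2)).
exact: (@integrable_snd _ _ _ _ _ U nu1 h).
Qed.

Lemma integrable_noise2 (h : R -> \bar R) : N.-integrable setT h ->
  Q.-integrable setT (fun w => h w.2).
Proof.
exact: (@integrable_snd _ _ _ _ _ (U \x nu1 : probability _ _) N).
Qed.

(** The selection is independent of the incomes of its step: by Fubini the second income is
    integrated out, then the first, and the uniform variable last. *)
Lemma integral_noise_action (s : history R) (h1 h2 : R -> R) :
  nu1.-integrable setT (EFin \o h1) -> N.-integrable setT (EFin \o h2) ->
  \int[Q]_w (if is_arm1 (next_action M sigma s w)
             then h1 w.1.2 else h2 w.2)%:E =
  (prob_arm1 M sigma s)%:E * \int[nu1]_x (h1 x)%:E +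
  (1 - prob_arm1 M sigma s)%:E * \int[N]_x (h2 x)%:E.
Proof.
move=> ih1 ih2.
have mh1 : measurable_fun setT h1 by apply/measurable_EFinP; exact: measurable_int ih1.
have mh2 : measurable_fun setT h2 by apply/measurable_EFinP; exact: measurable_int ih2.
have mb d (T : measurableType d) (w : T -> noise R) : measurable_fun setT w ->
    measurable_fun setT (fun t => is_arm1 (next_action M sigma s (w t))).
  move=> mw; case: s => k X n a.
  exact: (@measurable_next_action _ M sigma _ T k n a (cst X)).
pose F (w : noise R) :=
  (if is_arm1 (next_action M sigma s w) then h1 w.1.2 else h2 w.2)%:E.
have iF : Q.-integrable setT F.
  apply: (@le_integrable _ _ _ Q _ _ _
      (fun w => `|(h1 w.1.2)%:E| + `|(h2 w.2)%:E|)) => //.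
  - apply/measurable_EFinP; apply: measurable_fun_if => //.
    + exact: mb.
    + apply: measurable_funTS; apply: (measurableT_comp mh1).
      by do 2 apply: measurableT_comp => //.
    + by apply: measurable_funTS; apply: (measurableT_comp mh2).
  - move=> w _; rewrite /F [leRHS]gee0_abs ?adde_ge0//.
    by case: ifP => _; rewrite ?leeDl ?leeDr.
  - apply: integrableD => //.
      exact: (integrable_noise1 (integrable_abse ih1)).
    exact: (integrable_noise2 (integrable_abse ih2)).
have [c1 c1E] : exists c, \int[nu1]_x (h1 x)%:E = c%:E.
  by exists (fine (\int[nu1]_x (h1 x)%:E)); rewrite fineK// integrable_fin_num.
have [c2 c2E] : exists c, \int[N]_x (h2 x)%:E = c%:E.
  by exists (fine (\int[N]_x (h2 x)%:E)); rewrite fineK// integrable_fin_num.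
pose G (v : measurableTypeR R * measurableTypeR R) :=
  (if is_arm1 (next_action M sigma s (v, 0%R)) then h1 v.2 else c2)%:E.
have FG : fubini_F N F = G.
  apply/funext => v; rewrite /fubini_F /F /G.
  have bE x : next_action M sigma s (v, x) = next_action M sigma s (v, 0%R) by [].
  under eq_integral do rewrite bE.
  case: ifP => _ /=; last by rewrite c2E.
  by rewrite (integral_cst N measurableT (h1 v.2)%:E) /= probability_setT mule1.
have iG : (U \x nu1).-integrable setT G.
  by rewrite -FG; exact: (@integrable_fubini_F _ _ _ _ _ (U \x nu1 : probability _ _) N).
transitivity (\int[(U \x nu1)]_v G v).
  rewrite -FG; symmetry.
  exact: (@integral12_prod_meas1 _ _ _ _ _ (U \x nu1 : probability _ _) N F).
rewrite -(@integral12_prod_meas1 _ _ _ _ _ U nu1 G)//.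
rewrite c1E c2E -!EFinM -EFinD -integral_uniform_action.
apply: eq_integral => u _; rewrite /fubini_F /G.
have bE x : next_action M sigma s ((u, x), 0%R) = next_action M sigma s ((u, 0%R), 0%R) by [].
under eq_integral do rewrite bE.
case: ifP => _ /=; first by rewrite c1E.
by rewrite (integral_cst nu1 measurableT c2%:E) /= probability_setT mule1.
Qed.

Lemma incomes_cons (s : history R) (w : noise R) (ws : seq (noise R)) :
  (\sum_(x <- incomes M sigma s (w :: ws)) x =
  if is_arm1 (next_action M sigma s w)
  then w.1.2 + \sum_(x <- incomes M sigma (update s arm1 0) ws) x
  else w.2 + \sum_(x <- incomes M sigma (update s arm2 w.2) ws) x)%R.
Proof. by rewrite /= big_cons; case: next_action. Qed.

Lemma measurable_incomes j k n a : measurable_fun setT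
  (fun p : measurableTypeR R * j.-tuple (noise R) =>
   \sum_(x <- incomes M sigma (History k p.1 n a) p.2) x)%R.
Proof.
elim: j k n a => [|j IH] k n a.
  under eq_fun => p.
    rewrite (tuple0 p.2) /= big_nil.
    over.
  exact: measurable_cst.
pose T := (measurableTypeR R * (j.+1).-tuple (noise R))%type.
pose hd (p : T) : noise R := thead p.2.
pose tl (p : T) : j.-tuple (noise R) := [tuple of behead p.2].
have mhd : measurable_fun setT hd.
  by apply: (measurableT_comp (measurable_tnth ord0)).
have mtl : measurable_fun setT tl.
  by apply: (measurableT_comp (@measurable_behead _ _ j)).
under eq_fun => p.
  rewrite (tuple_eta p.2) incomes_cons.
  over.
apply: measurable_fun_if => //=.
- exact: (@measurable_next_action _ M sigma _ T k n a fst hd).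
- apply: measurable_funTS; apply: measurable_funD.
    by do 2 apply: measurableT_comp => //.
  have mp : measurable_fun setT (fun p : T => (p.1, tl p)).
    exact: measurable_fun_pair.
  exact: (measurableT_comp (IH k.+1 n arm1) mp).
- apply: measurable_funTS; apply: measurable_funD.
    exact: measurableT_comp.
  have mp : measurable_fun setT (fun p : T => ((p.1 + (hd p).2)%R, tl p)).
    apply: measurable_fun_pair => //; apply: measurable_funD => //.
    exact: measurableT_comp.
  exact: (measurableT_comp (IH k n.+1 arm2) mp).
Qed.

Lemma measurable_incomes_from j s : measurable_fun setT
  (fun ws : j.-tuple (noise R) => (\sum_(x <- incomes M sigma s ws) x)%:E).
Proof.
case: s => k X n a; apply/measurable_EFinP.
have mp : measurable_fun setT (fun ws : j.-tuple (noise R) =>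
    (X, ws) : measurableTypeR R * j.-tuple (noise R)).
  exact: measurable_fun_pair.
exact: (measurableT_comp (@measurable_incomes j k n a) mp).
Qed.

(** Both potential incomes are counted at every step, so this dominating function depends neither on
    the strategy nor on the history. *)
Let bound (ws : seq (noise R)) : R := (\sum_(w <- ws) (`|w.1.2| + `|w.2|))%R.

Let bound_ge0 ws : (0 <= bound ws)%R.
Proof. by apply: sumr_ge0 => w _; rewrite addr_ge0. Qed.

Lemma incomes_bound s (ws : seq (noise R)) :
  (`|\sum_(x <- incomes M sigma s ws) x| <=
   \sum_(w <- ws) (`|w.1.2| + `|w.2|))%R.
Proof.
elim: ws s => [|w ws IH] s; first by rewrite !big_nil normr0.
rewrite incomes_cons big_cons; case: ifP => _;
  apply: (le_trans (ler_normD _ _)); apply: lerD => //; first by rewrite lerDl.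
by rewrite lerDr.
Qed.

Let measurable_bound j : measurable_fun setT
  (fun ws : j.-tuple (noise R) => (bound ws)%:E).
Proof.
apply/measurable_EFinP; rewrite /bound; under eq_fun do rewrite big_tuple.
apply: measurable_sum => i; apply: measurable_funD.
  by do 3 apply: measurableT_comp => //; exact: measurable_tnth.
by do 2 apply: measurableT_comp => //; exact: measurable_tnth.
Qed.

Let integrable_bound_cons j :
  (Qs j).-integrable setT (fun ws => (bound ws)%:E) ->
  (Q \x Qs j).-integrable setT (fun p => (bound (tcons p))%:E).
Proof.
move=> IH.
rewrite (_ : (fun p => _) = (fun p : noise R * j.-tuple (noise R) =>
    (`|p.1.1.2| + `|p.1.2|)%:E) \+
    (fun p : noise R * j.-tuple (noise R) => (bound p.2)%:E)); last first.
  by apply/funext => p /=; rewrite /bound big_cons EFinD.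
apply: integrableD => //.
  apply: (@integrable_fst _ _ _ _ _ Q (Qs j) (fun w => (`|w.1.2| + `|w.2|)%:E)).
  rewrite (_ : (fun w => _) = (fun w : noise R => `|w.1.2|%:E) \+
    (fun w : noise R => `|w.2|%:E)); last by apply/funext => w /=; rewrite EFinD.
  apply: integrableD => //.
    exact: (integrable_noise1 (integrable_abse nu1_integrable)).
  exact: (integrable_noise2 (integrable_abse (normal_id_integrable m D0))).
exact: (@integrable_snd _ _ _ _ _ Q (Qs j) _ IH).
Qed.

Let integrable_bound j : (Qs j).-integrable setT (fun ws => (bound ws)%:E).
Proof.
elim: j => [|j IH].
  apply: (eq_integrable measurableT (cst 0)); last exact: integrable0.
  by move=> ws _; rewrite (tuple0 ws) /bound big_nil.
apply: (@integrable_pushforward _ _ _ _ R _ (@measurable_tcons R j)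
  (Q \x Qs j) setT) => //; first exact: measurable_bound.
by rewrite preimage_setT; exact: integrable_bound_cons.
Qed.

Lemma integrable_incomes j s :
  (Qs j).-integrable setT (fun ws => (\sum_(x <- incomes M sigma s ws) x)%:E).
Proof.
apply: (@le_integrable _ _ _ (Qs j) _ _ _ (fun ws => (bound ws)%:E)) => //.
  exact: measurable_incomes_from.
by move=> ws _; rewrite lee_fin [leRHS]ger0_norm ?incomes_bound.
Qed.


Lemma regret_fin_num j s : regret D M sigma m j s \is a fin_num.
Proof.
rewrite ge0_fin_numE ?regret_ge0//.
by rewrite (le_lt_trans (regret_le M sigma D0 m j s))// ltry.
Qed.

(** Fubini separates the first noise from the others, to which the induction hypothesis applies at
    the updated history. The costs match because [m = Num.max 0 m - Num.max 0 (- m)]. *)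
Lemma integral_incomes j s :
  \int[Qs j]_ws (\sum_(x <- incomes M sigma s ws) x)%:E =
  (j%:R * Num.max 0 m)%:E - regret D M sigma m j s.
Proof.
elim: j s => [|j IH] s.
  rewrite mul0r sub0e oppe0; apply: integral0_eq => ws _.
  by rewrite (tuple0 ws) /= big_nil.
pose f (ws : j.+1.-tuple (noise R)) := (\sum_(x <- incomes M sigma s ws) x)%:E.
have mf : measurable_fun setT f by exact: measurable_incomes_from.
have iF : (Q \x Qs j).-integrable setT (f \o @tcons R j).
  apply: (@le_integrable _ _ _ (Q \x Qs j) _ _ _
      (fun p => (bound (tcons p))%:E)) => //.
  - exact: (measurableT_comp mf (@measurable_tcons R j)).
  - by move=> p _; rewrite lee_fin [leRHS]ger0_norm ?incomes_bound.
  - exact/integrable_bound_cons/integrable_bound.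
(* [c] is the mean income of the better arm over the [j] later steps. [h1] and [h2] are the expected
   total income given the income of the present step; [fine] makes them real-valued, as
   [integral_noise_action] requires. *)
pose c := (j%:R * Num.max 0 m)%R.
pose r1 := fine (regret D M sigma m j (update s arm1 0%R)).
pose r2 y := fine (regret D M sigma m j (update s arm2 y)).
pose h1 (x : R) := (x + (c - r1))%R.
pose h2 (y : R) := ((y + c) - r2 y)%R.
have r2E y : (r2 y)%:E = regret D M sigma m j (update s arm2 y).
  by rewrite fineK// regret_fin_num.
have mr2 : measurable_fun setT (fun y => (r2 y)%:E).
  under eq_fun do rewrite r2E.
  case: s {iF mf} @f @r1 @r2 @h1 @h2 r2E => k X n a _ _ _ _ _ _.
  apply: (measurableT_comp (measurable_regret_income M sigma D0 m j k n.+1 arm2)).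
  exact: measurable_funD.
have ir2 : N.-integrable setT (fun y => (r2 y)%:E).
  apply: (@le_integrable _ _ _ N _ _ _ (EFin \o cst (j%:R * `|m|)%R)) => //.
    move=> y _; rewrite r2E gee0_abs ?regret_ge0// (le_trans (regret_le _ _ D0 _ _ _))//.
    by rewrite lee_fin ler_norm.
  exact: finite_measure_integrable_cst.
have ih1 : nu1.-integrable setT (EFin \o h1).
  rewrite (_ : EFin \o h1 = (fun x => x%:E) \+ (EFin \o cst (c - r1)%R))//.
  by apply: integrableD => //; exact: finite_measure_integrable_cst.
have iid : N.-integrable setT (fun y => y%:E) by exact: normal_id_integrable.
have iidc : N.-integrable setT (fun y => y%:E + (EFin \o cst c) y).
  by apply: integrableD => //; exact: finite_measure_integrable_cst.
have ih2 : N.-integrable setT (EFin \o h2).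
  rewrite (_ : EFin \o h2 =
    (fun y => y%:E + (EFin \o cst c) y) \- (fun y => (r2 y)%:E))//.
  exact: integrableB.
have I1 : \int[nu1]_x (h1 x)%:E = (c - r1)%:E.
  transitivity (\int[nu1]_x (x%:E + (EFin \o cst (c - r1)%R) x)) => //.
  rewrite integralD//; last exact: finite_measure_integrable_cst.
  rewrite (integral_cst nu1 measurableT (c - r1)%:E) /= probability_setT mule1.
  by move: nu1_mean; rewrite unlock => ->; rewrite add0e.
have I2 : \int[N]_y (h2 y)%:E = (m + c)%:E - \int[N]_y (r2 y)%:E.
  transitivity (\int[N]_y ((y%:E + (EFin \o cst c) y) - (r2 y)%:E)) => //.
  rewrite integralB// integralD//; last exact: finite_measure_integrable_cst.
  rewrite (integral_cst N measurableT c%:E) /= probability_setT mule1.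
  by rewrite integral_normal_id.
have [i2 i2E] : exists i, \int[N]_y (r2 y)%:E = i%:E.
  by exists (fine (\int[N]_y (r2 y)%:E)); rewrite fineK// integrable_fin_num.
have i2E' : \int[mu]_y (regret D M sigma m j (update s arm2 y) * (gauss D m y)%:E)
    = i2%:E.
  rewrite -i2E ge0_integral_normal_prob//; last first.
    by move=> y; rewrite r2E regret_ge0.
  by apply: eq_integral => y _; rewrite r2E.
transitivity (\int[(Q \x Qs j)]_p (f \o @tcons R j) p).
  exact: integral_distribution.
rewrite -(@integral12_prod_meas1 _ _ _ _ _ Q (Qs j) _ iF).
transitivity (\int[Q]_w (if is_arm1 (next_action M sigma s w)
    then h1 w.1.2 else h2 w.2)%:E).
  apply: eq_integral => w _; rewrite /fubini_F /f /=.
  have split_head (x : R) s' :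
      \int[Qs j]_ws (x + \sum_(z <- incomes M sigma s' ws) z)%:E =
      x%:E + (c%:E - regret D M sigma m j s').
    rewrite -IH.
    transitivity (\int[Qs j]_ws ((EFin \o cst x) ws +
      (\sum_(z <- incomes M sigma s' ws) z)%:E)) => //.
    rewrite integralD//; last exact: integrable_incomes.
      by rewrite (integral_cst (Qs j) measurableT x%:E) /= probability_setT mule1.
    exact: finite_measure_integrable_cst.
  under eq_integral do rewrite incomes_cons.
  case: ifP => _; rewrite split_head /h1 /h2.
    by rewrite -(fineK (regret_fin_num _ _)) -EFinB -EFinD.
  by rewrite -r2E -EFinB -EFinD addrA.
set p := prob_arm1 M sigma s.
have -> : regret D M sigma m j.+1 s =
    (p * (Num.max 0 m + r1) + (1 - p) * (Num.max 0 (- m) + i2))%:E.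
  have r1E : regret D M sigma m j
      (History (napp1 s).+1 (income2 s) (napp2 s) arm1) = r1%:E.
    by rewrite fineK// regret_fin_num.
  by rewrite /= i2E' r1E -/p !(EFinD, EFinM).
rewrite integral_noise_action// I1 I2 i2E -/p.
rewrite -!EFinB -!EFinM -EFinD; congr EFin; rewrite /c.
have mE : m = (Num.max 0 m - Num.max 0 (- m))%R.
  by case: (lerP 0 m) => m0; case: (lerP 0 (- m)) => m0'; lra.
by rewrite -natr1 [X in (X + _ - i2)%R]mE; ring.
Qed.

Lemma loss_regret n :
  loss D n M nu1 sigma m = regret D M sigma m n (history0 R).
Proof.
rewrite /loss unlock integral_incomes.
rewrite -(fineK (regret_fin_num n (history0 R))) -!EFinB; congr EFin; ring.
Qed.

End loss_regret.

(** * The dynamic programming equation *)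

Section dynamic_programming.
Context (R : realType) (C D : R) (M : nat) (lambda : R -> R).
Hypotheses (D0 : 0 < D) (M0 : (0 < M)%N).
Hypothesis measurable_lambda : measurable_fun `[- C, C] lambda.
Hypothesis lambda_ge0 : forall m, m \in `[- C, C] -> 0 <= lambda m.
Local Notation mu := (@lebesgue_measure R).

(** Extension by 0 lets every integral over [m] run over the whole line. *)
Let prior : R -> R := lambda \_ `[- C, C].

Let prior_in m : m \in `[- C, C] -> prior m = lambda m.
Proof. by move=> mC; rewrite /prior patchE mem_setE mC. Qed.

Let prior_out m : m \notin `[- C, C] -> prior m = 0.
Proof. by move=> /negbTE mC; rewrite /prior patchE mem_setE mC. Qed.

Let prior_ge0 m : 0 <= prior m.
Proof.
have [mC|mC] := boolP (m \in `[- C, C]); last by rewrite prior_out.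
by rewrite prior_in// lambda_ge0.
Qed.

Let measurable_prior : measurable_fun setT prior.
Proof. exact/(measurable_restrictT _ (measurable_itv _)). Qed.

Let weight n X m : R := lik D n X m * prior m.

Let weight_ge0 n X m : 0 <= weight n X m.
Proof. by rewrite mulr_ge0// lik_ge0. Qed.

Let measurable_weight d (T : measurableType d) n (X m : T -> R) :
  measurable_fun setT X -> measurable_fun setT m ->
  measurable_fun setT (fun t => weight n (X t) (m t)).
Proof.
move=> mX mm; apply: measurable_funM; first exact: measurable_lik.
exact: (measurableT_comp measurable_prior).
Qed.

Local Open Scope ereal_scope.

(** The integrand cuts the domain down by itself: [Num.max 0 m] vanishes for [m < 0] and [prior] for
    [m > C]. *)
Lemma g1E X n :
  g1 C D lambda X n = \int[mu]_m ((Num.max 0 m)%:E * (weight n X m)%:E).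
Proof.
rewrite /g1 integral_mkcond; apply: eq_integral => m _.
rewrite patchE mem_setE -EFinM /weight; case: ifPn => [|].
  rewrite in_itv/= => /andP[m0 mC]; rewrite prior_in; last first.
    by rewrite in_itv/= mC andbT (le_trans _ m0)// oppr_le0 (le_trans m0).
  by rewrite max_r// mulrA.
rewrite in_itv/= negb_and -!ltNge => /orP[m0|mC].
  by rewrite max_l ?mul0r// ltW.
by rewrite prior_out ?mulr0// in_itv/= negb_and -!ltNge mC orbT.
Qed.

Lemma g2E X n :
  g2 C D lambda X n = \int[mu]_m ((Num.max 0 (- m))%:E * (weight n X m)%:E).
Proof.
rewrite /g2 integral_mkcond; apply: eq_integral => m _.
rewrite patchE mem_setE -EFinM /weight; case: ifPn => [|].
  rewrite in_itv/= => /andP[mC m0]; rewrite prior_in; last first.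
    by rewrite in_itv/= mC/= (le_trans m0)// -oppr_le0 (le_trans mC).
  by rewrite ler0_norm// max_r ?oppr_ge0// mulrA.
rewrite in_itv/= negb_and -!ltNge => /orP[mC|m0].
  by rewrite prior_out ?mulr0// in_itv/= negb_and -!ltNge mC.
by rewrite max_l ?mul0r// oppr_le0 ltW.
Qed.

Lemma g1_ge0 X n : 0 <= g1 C D lambda X n.
Proof.
rewrite g1E; apply: integral_ge0 => m _.
by rewrite -EFinM lee_fin mulr_ge0// le_max lexx.
Qed.

Lemma g2_ge0 X n : 0 <= g2 C D lambda X n.
Proof.
rewrite g2E; apply: integral_ge0 => m _.
by rewrite -EFinM lee_fin mulr_ge0// le_max lexx.
Qed.

Lemma measurable_g1 n : measurable_fun setT (fun X => g1 C D lambda X n).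
Proof.
under eq_fun do rewrite g1E.
apply: (@measurable_fun_fubini_tonelli_F _ _ _ _ _ _
  (fun p : measurableTypeR R * measurableTypeR R =>
     (Num.max 0 p.2)%:E * (weight n p.1 p.2)%:E)) => [|p].
  apply: emeasurable_funM; apply/measurable_EFinP.
    exact: measurable_maxr.
  exact: measurable_weight.
by rewrite -EFinM lee_fin mulr_ge0// le_max lexx.
Qed.

Lemma measurable_g2 n : measurable_fun setT (fun X => g2 C D lambda X n).
Proof.
under eq_fun do rewrite g2E.
apply: (@measurable_fun_fubini_tonelli_F _ _ _ _ _ _
  (fun p : measurableTypeR R * measurableTypeR R =>
     (Num.max 0 (- p.2))%:E * (weight n p.1 p.2)%:E)) => [|p].
  apply: emeasurable_funM; apply/measurable_EFinP.
    by apply: measurable_maxr => //; exact: measurableT_comp.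
  exact: measurable_weight.
by rewrite -EFinM lee_fin mulr_ge0// le_max lexx.
Qed.

(* The expected loss over the last [r] batches, integrated against the
   unnormalized posterior density of [m] at history (k, X, n). *)
Definition posterior_regret (sigma : strategy R) r k X n a : \bar R :=
  \int[mu]_m (regret D M sigma m (r * M) (History k X n a) *
              (lik D n X m * (lambda \_ `[(- C)%R, C]) m)%:E).

Lemma measurable_posterior_regret sigma r k n a :
  measurable_fun setT (fun X => posterior_regret sigma r k X n a).
Proof.
apply: (@measurable_fun_fubini_tonelli_F _ _ _ _ _ _
  (fun q : measurableTypeR R * measurableTypeR R =>
     regret D M sigma q.2 (r * M) (History k q.1 n a) *
     (weight n q.1 q.2)%:E)) => [|q].
  apply: emeasurable_funM; last by apply/measurable_EFinP/measurable_weight.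
  have mswap : measurable_fun setT (fun q : measurableTypeR R * measurableTypeR R =>
      (q.2, q.1)).
    exact: measurable_fun_pair.
  exact: (measurableT_comp (measurable_regret M sigma D0 (r * M) k n a) mswap).
by rewrite mule_ge0 ?regret_ge0 ?lee_fin ?weight_ge0.
Qed.

(** The last action [a] disappears because a selection is made here. The condition on [X] at [n = 0]
    is what [lik_mul_gauss] requires: the likelihood of [X] is then replaced by 1, and [X + Y] must
    reduce to [Y]. *)
Lemma posterior_regret_batch sigma r k X n a :
  (M %| k)%N -> (M %| n)%N -> (n = 0%N -> X = 0%R) ->
  posterior_regret sigma r.+1 k X n a =
  (select sigma k X n)%:E *
    (M%:R%:E * g1 C D lambda X n + posterior_regret sigma r (k + M) X n arm1) +
  (1 - select sigma k X n)%:E *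
    (M%:R%:E * g2 C D lambda X n +
     \int[mu]_Y (posterior_regret sigma r k (X + Y)%R (n + M) arm2 *
                 (hker D M n (M%:R * X - n%:R * Y))%:E)).
Proof.
move=> Mk Mn n0X; rewrite /posterior_regret.
have /andP[p0 p1] := select_prob sigma k X n.
set p := select sigma k X n in p0 p1 *.
have q0 : (0 <= 1 - p)%R by rewrite subr_ge0.
have MD0 : (0 < M%:R * D)%R by rewrite mulr_gt0// ltr0n.
pose reg b k' m X' n' := regret D M sigma m (r * M) (History k' X' n' b).
have reg0 b k' m X' n' : 0 <= reg b k' m X' n' by exact: regret_ge0.
have w0 m : 0 <= (weight n X m)%:E by rewrite lee_fin.
have mw : measurable_fun setT (fun m => (weight n X m)%:E).
  by apply/measurable_EFinP/measurable_weight.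
have mreg b k' n' : measurable_fun setT
    (fun q : measurableTypeR R * measurableTypeR R => reg b k' q.1 q.2 n').
  exact: measurable_regret.
pose R1 m := reg arm1 (k + M)%N m X n.
pose J m := \int[mu]_Y (reg arm2 k m (X + Y)%R (n + M)%N *
                        (gauss (M%:R * D) (M%:R * m) Y)%:E).
have R10 m : 0 <= R1 m by exact: reg0.
have mR1 : measurable_fun setT R1.
  have mX : measurable_fun setT
      (fun m => (m, X) : measurableTypeR R * measurableTypeR R).
    exact: measurable_fun_pair.
  exact: (measurableT_comp (mreg arm1 (k + M)%N n) mX).
pose f (q : measurableTypeR R * measurableTypeR R) :=
  reg arm2 k q.1 (X + q.2)%R (n + M)%N *
  (gauss (M%:R * D) (M%:R * q.1) q.2)%:E.
have f0 q : 0 <= f q by rewrite mule_ge0// lee_fin gauss_ge0.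
have mregX : measurable_fun setT
    (fun q : measurableTypeR R * measurableTypeR R =>
     reg arm2 k q.1 (X + q.2)%R (n + M)%N).
  have mX : measurable_fun setT (fun q : measurableTypeR R * measurableTypeR R =>
      (q.1, (X + q.2)%R) : measurableTypeR R * measurableTypeR R).
    by apply: measurable_fun_pair => //; exact: measurable_funD.
  exact: (measurableT_comp (mreg arm2 k (n + M)%N) mX).
have mf : measurable_fun setT f.
  apply: emeasurable_funM => //.
  by apply/measurable_EFinP/measurable_gauss => //; exact: measurable_funM.
have J0 m : 0 <= J m by apply: integral_ge0 => Y _; exact: (f0 (m, Y)).
have mJ : measurable_fun setT J.
  exact: (@measurable_fun_fubini_tonelli_F _ _ _ _ _ _ f).
have mmax1 : measurable_fun setT (fun m : R => (Num.max 0 m)%:E).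
  by apply/measurable_EFinP; exact: measurable_maxr.
have mmax2 : measurable_fun setT (fun m : R => (Num.max 0 (- m))%:E).
  by apply/measurable_EFinP; exact: measurable_maxr.
have max0 x : 0 <= (Num.max 0 x)%:E :> \bar R by rewrite lee_fin le_max lexx.
(* Both arms share this computation: [b] is the probability of the arm, [x m] is [m] or [- m], and
   [K] is the regret after the batch. *)
have half b (x : R -> R) K : (0 <= b)%R ->
    measurable_fun setT (fun m => (Num.max 0 (x m))%:E) ->
    measurable_fun setT K -> (forall m, 0 <= K m) ->
    \int[mu]_m (b%:E * (((M%:R)%:E * (Num.max 0 (x m))%:E + K m) *
      (weight n X m)%:E)) =
    b%:E * (M%:R%:E * \int[mu]_m ((Num.max 0 (x m))%:E * (weight n X m)%:E) +
      \int[mu]_m (K m * (weight n X m)%:E)).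
  move=> b0 mx mK K0.
  have M0' : 0 <= M%:R%:E :> \bar R by rewrite lee_fin.
  have mMx : measurable_fun setT (fun m => M%:R%:E * (Num.max 0 (x m))%:E).
    by apply: emeasurable_funM => //; exact: measurable_cst.
  have e0 m : 0 <= M%:R%:E * (Num.max 0 (x m))%:E + K m.
    by rewrite adde_ge0// mule_ge0.
  rewrite ge0_integralZl//; last 2 first.
  - by apply: emeasurable_funM => //; exact: emeasurable_funD.
  - by move=> m _; rewrite mule_ge0.
  congr (_ * _).
  under eq_integral => m _ do rewrite ge0_muleDl ?mule_ge0// -muleA.
  rewrite ge0_integralD//; last 4 first.
  - by move=> m _; rewrite !mule_ge0.
  - apply: emeasurable_funM; first exact: measurable_cst.
    exact: emeasurable_funM.
  - by move=> m _; rewrite mule_ge0.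
  - exact: emeasurable_funM.
  rewrite ge0_integralZl//; first exact: emeasurable_funM.
  by move=> m _; rewrite mule_ge0.
transitivity (\int[mu]_m (
    p%:E * ((M%:R%:E * (Num.max 0 m)%:E + R1 m) * (weight n X m)%:E) +
    (1 - p)%:E * ((M%:R%:E * (Num.max 0 (- m))%:E + J m) * (weight n X m)%:E))).
  apply: eq_integral => m _.
  rewrite mulSn regret_batch// -/p -/(weight n X m).
  have EM (x : R) : (M%:R * x)%:E = M%:R%:E * x%:E by exact: EFinM.
  rewrite !EM ge0_muleDl.
  - by rewrite -!muleA.
  - by rewrite mule_ge0// adde_ge0// ?mule_ge0// ?regret_ge0.
  - by rewrite mule_ge0// adde_ge0// ?mule_ge0//; exact: J0.
rewrite ge0_integralD//; last 4 first.
- by move=> m _; rewrite mule_ge0// mule_ge0// adde_ge0// ?mule_ge0.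
- apply: emeasurable_funM; first exact: measurable_cst.
  apply: emeasurable_funM => //; apply: emeasurable_funD => //.
  by apply: emeasurable_funM => //; exact: measurable_cst.
- by move=> m _; rewrite mule_ge0// mule_ge0// adde_ge0// ?mule_ge0.
- apply: emeasurable_funM; first exact: measurable_cst.
  apply: emeasurable_funM => //; apply: emeasurable_funD => //.
  by apply: emeasurable_funM => //; exact: measurable_cst.
rewrite (half p id R1)// (half (1 - p)%R -%R J)// -g1E -g2E.
congr (_ + _ * (_ + _)).
transitivity (\int[mu]_m \int[mu]_Y (f (m, Y) * (weight n X m)%:E)).
  apply: eq_integral => m _; rewrite ge0_integralZr//.
  by have := measurableT_comp mf (@measurable_pair1 _ _ _ _ m).
pose g (q : measurableTypeR R * measurableTypeR R) := f q * (weight n X q.1)%:E.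
have mg : measurable_fun setT g.
  by apply: emeasurable_funM => //; apply/measurable_EFinP/measurable_weight.
have g0 q : 0 <= g q by rewrite mule_ge0// lee_fin.
rewrite (@fubini_tonelli _ _ _ _ _ mu mu g mg g0).
apply: eq_integral => Y _; rewrite /g /f /=.
rewrite -ge0_integralZr//; last 3 first.
- apply: emeasurable_funM.
    have mY : measurable_fun setT (fun m : measurableTypeR R =>
        (m, (X + Y)%R) : measurableTypeR R * measurableTypeR R).
      exact: measurable_fun_pair.
    exact: (measurableT_comp (mreg arm2 k (n + M)%N) mY).
  by apply/measurable_EFinP/measurable_weight.
- by move=> m _; rewrite mule_ge0 ?lee_fin ?weight_ge0//; exact: reg0.
- by rewrite lee_fin hker_ge0.
(* Bayes' rule: the batch income turns the likelihood of [X] into that of [X + Y]. The remaining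
   factor [hker] is free of [m], which is why it stands outside the posterior integral. *)
apply: eq_integral => m _; rewrite -!muleA -!EFinM; congr (_ * _%:E).
rewrite /weight mulrA [X in (X * _)%R]mulrC lik_mul_gauss//.
by rewrite -!mulrA; congr (_ * _)%R; rewrite mulrC.
Qed.

End dynamic_programming.

(** * Lower bound for every strategy and an optimal strategy *)

Section optimality.
Context (R : realType) (C D : R) (N M : nat) (lambda : R -> R).
Context (Rt Rt1 Rt2 : nat -> R -> nat -> \bar R).
Hypotheses (D0 : 0 < D) (M0 : (0 < M)%N).
Hypothesis measurable_lambda : measurable_fun `[- C, C] lambda.
Hypothesis lambda_ge0 : forall m, m \in `[- C, C] -> 0 <= lambda m.
Hypothesis dp : dp_solution C D N M lambda Rt Rt1 Rt2.
Local Notation mu := (@lebesgue_measure R).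
Local Open Scope ereal_scope.

Let remaining r k n : (k + n + r * M)%N = N -> (k + n <= N)%N.
Proof. by move=> <-; rewrite leq_addr. Qed.

Lemma dp_min r k n X : (M %| k)%N -> (M %| n)%N -> (k + n + r * M)%N = N ->
  (n = 0%N -> X = 0%R) -> Rt k X n = mine (Rt1 k X n) (Rt2 k X n).
Proof. by move=> Mk Mn /remaining knN nX; case: (dp Mk Mn knN nX). Qed.

Lemma dp_step r k n X : (M %| k)%N -> (M %| n)%N ->
  (k + n + r.+1 * M)%N = N -> (n = 0%N -> X = 0%R) ->
  Rt1 k X n = M%:R%:E * g1 C D lambda X n + Rt (k + M) X n /\
  Rt2 k X n = M%:R%:E * g2 C D lambda X n +
    \int[mu]_Y (Rt k (X + Y)%R (n + M) *
                (hker D M n (M%:R * X - n%:R * Y))%:E).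
Proof.
move=> Mk Mn knN nX; have [_ _] := dp Mk Mn (remaining knN) nX.
by apply; rewrite -knN -[X in (X < _)%N]addn0 ltn_add2l mulSn addn_gt0 M0.
Qed.

Lemma dp_end k n X : (M %| k)%N -> (M %| n)%N -> (k + n)%N = N ->
  (n = 0%N -> X = 0%R) -> Rt1 k X n = 0 /\ Rt2 k X n = 0.
Proof.
move=> Mk Mn knN nX.
by have [_ + _] := dp Mk Mn (eq_leq knN) nX; apply.
Qed.

Let next1 r k n : (k + n + r.+1 * M)%N = N -> (k + M + n + r * M)%N = N.
Proof. by move=> <-; rewrite mulSn; lia. Qed.

Let next2 r k n : (k + n + r.+1 * M)%N = N -> (k + (n + M) + r * M)%N = N.
Proof. by move=> <-; rewrite mulSn; lia. Qed.

(** After a batch of the second arm the side condition on [X] holds vacuously. *)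
Let nonzero n (X : R) : (n + M = 0)%N -> X = 0%R.
Proof. by move: M0; lia. Qed.

Lemma dp_ge0 r k n X : (M %| k)%N -> (M %| n)%N -> (k + n + r * M)%N = N ->
  (n = 0%N -> X = 0%R) -> 0 <= Rt k X n.
Proof.
elim: r k n X => [|r IH] k n X Mk Mn knN nX; rewrite (dp_min Mk Mn knN)//.
  move: knN; rewrite addn0 => knN.
  by have [-> ->] := dp_end Mk Mn knN nX; rewrite minxx.
have [-> ->] := dp_step Mk Mn knN nX.
have M0' : 0 <= M%:R%:E :> \bar R by rewrite lee_fin.
rewrite le_min; apply/andP; split; apply: adde_ge0.
- by rewrite mule_ge0// g1_ge0.
- by apply: IH => //; [rewrite dvdn_add|exact: next1].
- by rewrite mule_ge0// g2_ge0.
- apply: integral_ge0 => Y _; rewrite mule_ge0 ?lee_fin ?hker_ge0//.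
  by apply: IH => //; [rewrite dvdn_add|exact: next2|exact: nonzero].
Qed.

(** Stated for [Rt1] and [Rt2] separately because the optimal strategy compares them; [Rt] is their
    minimum. The restriction [0 < n] is where the equation determines the solution for every [X]. *)
Lemma dp_measurable r k n : (M %| k)%N -> (M %| n)%N ->
  (k + n + r * M)%N = N -> (0 < n)%N ->
  measurable_fun setT (fun X => Rt1 k X n) /\
  measurable_fun setT (fun X => Rt2 k X n).
Proof.
elim: r k n => [|r IH] k n Mk Mn knN n0.
  have nX (X : R) : n = 0%N -> X = 0%R by move=> n00; rewrite n00 in n0.
  move: knN; rewrite addn0 => knN.
  split; [under eq_fun do rewrite (dp_end Mk Mn knN (@nX _)).1|
          under eq_fun do rewrite (dp_end Mk Mn knN (@nX _)).2];
    exact: measurable_cst.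
have nX (X : R) : n = 0%N -> X = 0%R by move=> n00; rewrite n00 in n0.
have Mm : measurable_fun [set: measurableTypeR R] (fun=> M%:R%:E : \bar R).
  exact: measurable_cst.
have mRt k' n' : (M %| k')%N -> (M %| n')%N -> (k' + n' + r * M)%N = N ->
    (0 < n')%N -> measurable_fun setT (fun X => Rt k' X n').
  move=> Mk' Mn' kn' n0'; have [m1 m2] := IH k' n' Mk' Mn' kn' n0'.
  have nX' (X : R) : n' = 0%N -> X = 0%R by move=> n00; rewrite n00 in n0'.
  under eq_fun do rewrite (dp_min Mk' Mn' kn' (@nX' _)).
  exact: measurable_mine.
split.
  under eq_fun do rewrite (dp_step Mk Mn knN (@nX _)).1.
  apply: emeasurable_funD.
    by apply: emeasurable_funM => //; exact: measurable_g1.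
  by apply: mRt => //; [rewrite dvdn_add|exact: next1].
under eq_fun do rewrite (dp_step Mk Mn knN (@nX _)).2.
apply: emeasurable_funD.
  by apply: emeasurable_funM => //; exact: measurable_g2.
have mRtM : measurable_fun setT (fun X => Rt k X (n + M)).
  by apply: mRt => //; [rewrite dvdn_add|exact: next2|rewrite addn_gt0 n0].
apply: (@measurable_fun_fubini_tonelli_F _ _ _ _ _ _
  (fun q : measurableTypeR R * measurableTypeR R =>
     Rt k (q.1 + q.2)%R (n + M) *
     (hker D M n (M%:R * q.1 - n%:R * q.2))%:E)) => [|q].
  apply: emeasurable_funM.
    by apply: (measurableT_comp mRtM); exact: measurable_funD.
  apply/measurable_EFinP/measurable_hker => //.
  by apply: measurable_funB; exact: measurable_funM.
rewrite mule_ge0 ?lee_fin ?hker_ge0//.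
by apply: (@dp_ge0 r) => //; [rewrite dvdn_add|exact: next2|exact: nonzero].
Qed.


Let convex_ge_min (p : R) (x y : \bar R) : (0 <= p <= 1)%R ->
  mine x y <= p%:E * x + (1 - p)%:E * y.
Proof.
move=> /andP[p0 p1]; have q0 : (0 <= 1 - p)%R by rewrite subr_ge0.
rewrite -[leLHS]mul1e (_ : 1 = p%:E + (1 - p)%:E); last first.
  by rewrite -EFinD addrC subrK.
rewrite ge0_muleDl ?lee_fin//.
by apply: leeD; rewrite lee_wpmul2l ?lee_fin// ge_min lexx ?orbT.
Qed.

Lemma dp_le_posterior_regret sigma r k n X a :
  (M %| k)%N -> (M %| n)%N -> (k + n + r * M)%N = N ->
  (n = 0%N -> X = 0%R) ->
  Rt k X n <= posterior_regret C D M lambda sigma r k X n a.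
Proof.
elim: r k n X a => [|r IH] k n X a Mk Mn knN nX; rewrite (dp_min Mk Mn knN nX).
  move: knN; rewrite addn0 => knN.
  have [-> ->] := dp_end Mk Mn knN nX; rewrite minxx.
  by rewrite /posterior_regret integral0_eq// => m _; rewrite mul0n /= mul0e.
rewrite posterior_regret_batch//; have p01 := select_prob sigma k X n.
apply: (le_trans (convex_ge_min _ _ p01)); case/andP: p01 => p0 p1.
have MkM : (M %| k + M)%N by rewrite dvdn_add.
have MnM : (M %| n + M)%N by rewrite dvdn_add.
have [-> ->] := dp_step Mk Mn knN nX.
apply: leeD; rewrite lee_wpmul2l ?lee_fin ?subr_ge0//; apply: leeD => //.
  exact: IH (next1 knN) _.
have mXY : measurable_fun setT (fun Y : measurableTypeR R => (X + Y)%R).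
  exact: measurable_funD.
have mh : measurable_fun setT (fun Y : measurableTypeR R =>
    (hker D M n (M%:R * X - n%:R * Y))%:E).
  apply/measurable_EFinP/measurable_hker => //.
  by apply: measurable_funB => //; exact: measurable_funM.
(* [n + M] is positive even when [n = 0], so [dp_measurable] applies. *)
have mRt : measurable_fun setT (fun X => Rt k X (n + M)).
  have [m1 m2] := dp_measurable Mk MnM (next2 knN) (ltn_addl n M0).
  under eq_fun do rewrite (dp_min Mk MnM (next2 knN) (@nonzero n _)).
  exact: measurable_mine.
apply: ge0_le_integral => //=.
- move=> Y _; rewrite mule_ge0 ?lee_fin ?hker_ge0//.
  exact: (dp_ge0 Mk MnM (next2 knN) (@nonzero n _)).
- by apply: emeasurable_funM => //; exact: (measurableT_comp mRt mXY).
- apply: emeasurable_funM => //.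
  have mP : measurable_fun setT (fun X =>
      posterior_regret C D M lambda sigma r k X (n + M) arm2).
    exact: measurable_posterior_regret.
  exact: (measurableT_comp mP mXY).
- move=> Y _; rewrite lee_wpmul2r ?lee_fin ?hker_ge0//.
  exact: IH (next2 knN) (@nonzero n _).
Qed.

Hypothesis MN : (M %| N)%N.

(* At n = 0 the equation constrains its solution at X = 0 only. *)
Definition dp_select (k : nat) (X : R) (n : nat) : R :=
  let X' := if n == 0%N then 0%R else X in
  if [&& (M %| k)%N, (M %| n)%N, (k + n <= N)%N & Rt1 k X' n <= Rt2 k X' n]
  then 1%R else 0%R.

Lemma dp_select_prob k X n : (0 <= dp_select k X n <= 1)%R.
Proof. by rewrite /dp_select; case: ifP => _; rewrite ?lexx ler01. Qed.

Lemma dp_select_measurable k n : measurable_fun setT (fun X => dp_select k X n).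
Proof.
(* At [n = 0] the selection ignores [X]; for [n > 0] it compares two measurable functions. *)
rewrite /dp_select; have [_|n0] := eqVneq n 0%N; first exact: measurable_cst.
have [Mk|_] /= := boolP (M %| k)%N; last exact: measurable_cst.
have [Mn|_] /= := boolP (M %| n)%N; last exact: measurable_cst.
have [knN|_] /= := leqP (k + n) N; last exact: measurable_cst.
have E : (k + n + (N - (k + n)) %/ M * M)%N = N.
  by rewrite divnK ?subnKC// dvdn_sub// dvdn_add.
move: n0; rewrite -lt0n => /(dp_measurable Mk Mn E)[m1 m2].
by apply: measurable_fun_if => //; exact: measurable_fun_lee.
Qed.

Definition dp_strategy : strategy R :=
  Strategy dp_select_prob dp_select_measurable.

Lemma posterior_regret_dp_strategy r k n X a :
  (M %| k)%N -> (M %| n)%N -> (k + n + r * M)%N = N ->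
  (n = 0%N -> X = 0%R) ->
  posterior_regret C D M lambda dp_strategy r k X n a = Rt k X n.
Proof.
elim: r k n X a => [|r IH] k n X a Mk Mn knN nX; rewrite (dp_min Mk Mn knN nX).
  move: knN; rewrite addn0 => knN.
  have [-> ->] := dp_end Mk Mn knN nX; rewrite minxx.
  by rewrite /posterior_regret integral0_eq// => m _; rewrite mul0n /= mul0e.
have MkM : (M %| k + M)%N by rewrite dvdn_add.
have MnM : (M %| n + M)%N by rewrite dvdn_add.
rewrite posterior_regret_batch// IH//; last exact: next1.
under eq_integral do rewrite (IH _ _ _ _ Mk MnM (next2 knN) (@nonzero n _)).
have [<- <-] := dp_step Mk Mn knN nX.
rewrite /= /dp_select Mk Mn (remaining knN)/=.
(* On the domain of the equation, the substitution made in [dp_select] changes nothing. *)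
have -> : (if n == 0%N then 0%R else X) = X by case: eqVneq => // /nX.
rewrite minEle; case: ifP => _.
  by rewrite subrr mul0e adde0 mul1e.
by rewrite subr0 mul0e add0e mul1e.
Qed.

End optimality.

Theorem theorem2p1 (R : realType) (C D : R) (N M : nat)
    (nu1 : probability (measurableTypeR R) R) (lambda : R -> R)
    (Rt Rt1 Rt2 : nat -> R -> nat -> \bar R)
    (hC : 0 < C) (hD : 0 < D) (hN : (0 < N)%N) (hM : (0 < M)%N)
    (hMN : (M %| N)%N)
    (hnu1_int : nu1.-integrable [set: R] (fun x : R => x%:E))
    (hnu1_mean : ('E_nu1[fun x : R => x] = 0)%E)
    (hlambda : prior_density C lambda)
    (hlambda_neg :
      (0 < \int[lebesgue_measure]_(m in `[(- C)%R, 0%R]) (`|m| * lambda m)%:E)%E)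
    (hlambda_pos :
      (0 < \int[lebesgue_measure]_(m in `[0%R, C]) (m * lambda m)%:E)%E)
    (hRt : dp_solution C D N M lambda Rt Rt1 Rt2) :
  bayes_risk C D N M nu1 lambda = Rt 0%N 0 0%N /\
  exists sigma : strategy R,
    expected_loss C D N M nu1 lambda sigma = bayes_risk C D N M nu1 lambda.
Proof.
have [ml l0 _] := hlambda.
(* With no observations the likelihood is 1, so the posterior weight is the prior itself; [arm1] is
   the last action of [history0]. *)
have lossE sigma : expected_loss C D N M nu1 lambda sigma =
    posterior_regret C D M lambda sigma (N %/ M) 0 0 0 arm1.
  rewrite /expected_loss integral_mkcond; apply: eq_integral => m _.
  rewrite divnK// /lik/= mul1r !patchE; case: ifPn => mC; last by rewrite mule0.
  by rewrite loss_regret.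
have NE : (0 + 0 + N %/ M * M)%N = N by rewrite divnK.
pose sigma := dp_strategy hD hM ml l0 hRt hMN.
have optE : expected_loss C D N M nu1 lambda sigma = Rt 0%N 0 0%N.
  by rewrite lossE posterior_regret_dp_strategy ?dvdn0.
have riskE : bayes_risk C D N M nu1 lambda = Rt 0%N 0 0%N.
  apply/eqP; rewrite eq_le; apply/andP; split.
    by rewrite -optE; apply: ereal_inf_lbound; exists sigma.
  apply: le_ereal_inf_tmp => _ [tau _ <-]; rewrite lossE.
  by apply: (dp_le_posterior_regret hD hM ml l0 hRt) => //; rewrite dvdn0.
by split=> //; exists sigma; rewrite optE riskE.
Qed.
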